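(* For any $K>0$ there exist constants $C_1,C_2>0$ depending only on $K$ such that the following holds. Let $\mathbf{X}\in\mathbb{R}^p$ be a mean-zero, $K$-subgaussian random vector with covariance matrix $\boldsymbol{\Sigma}=\mathbb{E}(\mathbf{X}\mathbf{X}^T)\in\mathbb{R}^{p\times p}$. Let $\mathbf{X}_0,\dots,\mathbf{X}_n$ be i.i.d. copies of $\mathbf{X}$ and let $\mathbf{M}\in[0,1]^{p\times p}$ be a fixed symmetric matrix (mask). If the adaptive dithering parameters $\tilde\lambda_k\ge 0$ satisfy $\tilde\lambda_k^2=C_1\log(k)\lambda_k^2$, where $\lambda_k=\frac1k\sum_{j=0}^{k-1}\|\mathbf{X}_j\|_\infty$ for $1\le k\le n$, and $\boldsymbol{\Sigma}^{\mathrm{adap}}_n$ is the corresponding adaptively dithered one-bit estimator (defined in the context), then for any $\theta\ge C_2\max\{\log(p),\log(n)\}$ we have with probability at least $1-2e^{-\theta}$ $$\|\mathbf{M}\odot\boldsymbol{\Sigma}^{\mathrm{adap}}_n-\mathbf{M}\odot\boldsymbol{\Sigma}\|_\infty\lesssim_K\|\mathbf{M}\|_\infty\|\boldsymbol{\Sigma}\|_\infty\log(p)\log(n)\left(\frac{\theta^{3/2}}{\sqrt n}+\frac{\theta^2}{n}\right)$$ and $$\|\mathbf{M}\odot\boldsymbol{\Sigma}^{\mathrm{adap}}_n-\mathbf{M}\odot\boldsymbol{\Sigma}\|_F\lesssim_K\|\mathbf{M}\|_F\|\boldsymbol{\Sigma}\|_\infty\log(p)\log(n)\left(\frac{\theta^{3/2}}{\sqrt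 n}+\frac{\theta^2}{n}\right).$$
   Context: $a\lesssim_K b$ means $a\le C_K b$ for a constant $C_K>0$ depending only on $K$. A mean-zero random vector $\mathbf{X}$ in $\mathbb{R}^p$ is $K$-subgaussian if $\|\langle\mathbf{X},\mathbf{x}\rangle\|_{\psi_2}\le K(\mathbb{E}\langle\mathbf{X},\mathbf{x}\rangle^2)^{1/2}$ for all $\mathbf{x}\in\mathbb{R}^p$, where $\|X\|_{\psi_2}=\inf\{t>0:\mathbb{E}\exp(X^2/t^2)\le 2\}$. For a matrix $\mathbf{Z}$, $\|\mathbf{Z}\|_\infty=\max_{i,j}|Z_{i,j}|$ and $\|\mathbf{Z}\|_F=(\sum_{i,j}|Z_{i,j}|^2)^{1/2}$; for a vector, $\|\cdot\|_\infty$ is the maximum norm. $\odot$ is the entry-wise (Hadamard) product. $\mathrm{sign}$ acts entry-wise, with $\mathrm{sign}(x)=1$ if $x\ge0$ and $-1$ if $x<0$. Dithers: for $1\le k\le n$ the vectors $\boldsymbol{\tau}_k,\bar{\boldsymbol{\tau}}_k$ are independent and uniformly distributed in $[-\tilde\lambda_k,\tilde\lambda_k]^p$; they depend on the previous samples only via $\tilde\lambda_k$ and are independent of $\mathbf{X}_k$ and all future samples. That is, $\boldsymbol{\tau}_k=\tilde\lambda_k\mathbf{U}_k$ and $\bar{\boldsymbol{\tau}}_k=\tilde\lambda_k\bar{\mathbf{U}}_k$, where $\mathbf{U}_1,\bar{\mathbf{U}}_1,\dots,\mathbf{U}_n,\bar{\mathbf{U}}_n$ are i.i.d. uniform on $[-1,1]^p$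 and independent of $\mathbf{X}_0,\dots,\mathbf{X}_n$. Estimator: $\boldsymbol{\Sigma}^{\mathrm{adap}}_n=\frac12\boldsymbol{\Sigma}'_n+\frac12(\boldsymbol{\Sigma}'_n)^T$ with $$\boldsymbol{\Sigma}'_n=\sum_{k=1}^n\frac{\tilde\lambda_k^2}{n}\,\mathrm{sign}(\mathbf{X}_k+\boldsymbol{\tau}_k)\,\mathrm{sign}(\mathbf{X}_k+\bar{\boldsymbol{\tau}}_k)^T.$$
   Formalization: The formal theorem assumes p ≥ 2 and n ≥ 2; for p = 1 or n = 1 the factor log(p)log(n) is 0, so the bounds would require exact recovery of the masked covariance, which fails e.g. for a standard Gaussian X. *)

(* Defs.v *)
From HB Require Import structures.
From mathcomp Require Import all_boot all_order all_algebra.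
From mathcomp Require Import all_classical all_reals all_analysis.

Set Implicit Arguments.
Unset Strict Implicit.
Unset Printing Implicit Defensive.

Import Order.TTheory GRing.Theory Num.Theory.
Import numFieldNormedType.Exports.

Local Open Scope classical_set_scope.
Local Open Scope ring_scope.

(* The maximum norm of vectors and of matrices is MathComp-Analysis's norm
   [`|Z|] on ['M[R]_(m, n)].  Random vectors in R^p are measurable maps into
   [p.-tuple R] with its product (= Borel) sigma-algebra; [colv] turns their
   values into column vectors. *)

Definition colv (R : realType) (p : nat) (x : p.-tuple R) : 'cV[R]_p :=
  \col_i tnth x i.

Definition hadamard (R : realType) (m n : nat) (A B : 'M[R]_(m, n)) :
  'M[R]_(m, n) := map2_mx *%R A B.

Definition frobenius (R : realType) (m n : nat) (A : 'M[R]_(m, n)) : R :=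
  Num.sqrt (\sum_i \sum_j `|A i j| ^+ 2).

(* Unlike [Num.sg], the value at 0 is 1. *)
Definition sign1 (R : realType) (x : R) : R := if 0 <= x then 1 else -1.

Definition sign_mx (R : realType) (m n : nat) (A : 'M[R]_(m, n)) :
  'M[R]_(m, n) := map_mx (@sign1 R) A.

Definition inner (R : realType) (p : nat) (x y : 'cV[R]_p) : R :=
  \sum_i x i ord0 * y i ord0.

Section random_vectors.
Context d (T : measurableType d) (R : realType) (P : probability T R).

(* Equal to [+oo] when no [t] is admissible. *)
Definition psi2_norm (Y : T -> R) : \bar R :=
  ereal_inf [set t%:E | t in
    [set t : R | 0 < t /\
       ('E_P[fun w => expR (Y w ^+ 2 / t ^+ 2)] <= 2%:E)%E]].

Definition square_integrable (p : nat) (X : {RV P >-> p.-tuple R}) :=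
  forall i, (fun w => tnth (X w) i) \in Lfun P 2%:E.

Definition mean_zero (p : nat) (X : {RV P >-> p.-tuple R}) :=
  forall i, ('E_P[fun w => tnth (X w) i] = 0)%E.

Definition subgaussian (K : R) (p : nat) (X : {RV P >-> p.-tuple R}) :=
  forall x : 'cV[R]_p,
    (psi2_norm (fun w => inner (colv (X w)) x) <=
     K%:E * ('E_P[fun w => (inner (colv (X w)) x ^+ 2)%R] `^ 2^-1%R))%E.

(* [fine] only discards a junk value: the expectations are finite for
   square-integrable [X]. *)
Definition covmx (p : nat) (X : {RV P >-> p.-tuple R}) : 'M[R]_p :=
  \matrix_(i, j) fine 'E_P[fun w => (tnth (X w) i * tnth (X w) j)%R]%E.

(* Equality of laws is only required on measurable sets: the set function
   [distribution P X] has no meaning elsewhere. *)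
Definition same_law (p : nat) (X Y : {RV P >-> p.-tuple R}) :=
  forall A : set (p.-tuple R), measurable A ->
    distribution P X A = distribution P Y A.

(* The product rule for subfamilies is the case [B i = setT] outside of the
   subfamily. *)
Definition mutually_independent (p : nat) (I : finType)
    (F : I -> {RV P >-> p.-tuple R}) :=
  forall B : I -> set (p.-tuple R), (forall i, measurable (B i)) ->
    P (\bigcap_i (F i @^-1` B i)) = (\prod_i P (F i @^-1` B i))%E.

Lemma ltN11 : (-1 : R) < 1.
Proof. exact: gtrN. Qed.

(* The law of [U] is the p-fold product of the uniform law on [-1, 1]. *)
Definition uniform_on_cube (p : nat) (U : {RV P >-> p.-tuple R}) :=
  forall B : 'I_p -> set R, (forall i, measurable (B i)) ->
    distribution P U [set u | forall i, B i (tnth u i)] =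
    (\prod_i uniform_prob ltN11 (B i))%E.

(* The family X_0, ..., X_n, U_1, ..., U_n, V_1, ..., V_n; the sequences are
   indexed by [nat] but terms outside of these ranges play no role. *)
Definition sample_family (p n : nat) (X U V : nat -> {RV P >-> p.-tuple R})
    (s : 'I_n.+1 + ('I_n + 'I_n)) : {RV P >-> p.-tuple R} :=
  match s with
  | inl j => X j
  | inr (inl i) => U i.+1
  | inr (inr i) => V i.+1
  end.

End random_vectors.

Definition adap_lambda (R : realType) (p : nat) (x : nat -> 'cV[R]_p)
    (k : nat) : R :=
  k%:R^-1 * \sum_(0 <= j < k) `|x j|.

(* [x] are the samples, [tau] and [tau'] the dithers and [lam] the dithering
   parameters; only the indices 1, ..., n matter. *)
Definition adap_asym (R : realType) (p n : nat) (lam : nat -> R)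
    (x tau tau' : nat -> 'cV[R]_p) : 'M[R]_p :=
  \sum_(1 <= k < n.+1)
    (lam k ^+ 2 / n%:R) *:
      (sign_mx (x k + tau k) *m (sign_mx (x k + tau' k))^T).

Definition adap_estimator (R : realType) (p n : nat) (lam : nat -> R)
    (x tau tau' : nat -> 'cV[R]_p) : 'M[R]_p :=
  2^-1 *: adap_asym n lam x tau tau' +
  2^-1 *: (adap_asym n lam x tau tau')^T.

(* Main.v *)
Require Import Defs.
From HB Require Import structures.
From mathcomp Require Import all_boot all_order all_algebra.
From mathcomp Require Import all_classical all_reals all_analysis.
From mathcomp Require Import measurable_realfun ring lra.

Set Implicit Arguments.
Unset Strict Implicit.
Unset Printing Implicit Defensive.

Import Order.TTheory GRing.Theory Num.Theory.
Import numFieldNormedType.Exports.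

Local Open Scope classical_set_scope.
Local Open Scope ring_scope.

(* Write t = 2 K sqrt S with S the maximum norm of Sigma, and let clip l x be
   the truncation of x to [-l, l].  A dither u uniform on [-1, 1] satisfies
   E (l sign (x + l u)) = clip l x, so conditionally on X_0, ..., X_(k-1) the
   k-th summand of the (i, j) entry has mean E (clip l X_i * clip l X_j) at
   l = lamt k, which by subgaussianity differs from Sigma_ij by at most
   clip_bias t l = 8 t^2 exp (- l^2 / (2 t^2)).  The exponential moments of the
   bias-corrected sums therefore form a supermartingale, as in the proof of the
   Azuma-Hoeffding inequality, once lamt k is truncated at
   sqrt (C1 ln n * 24 K^2 S theta), a level that it does not reach unless some
   sample has a coordinate larger than sqrt (24 K^2 S theta).  It remains to
   bound the sum of the biases: the sample means of the largest-variance
   coordinate are at least a multiple of sqrt S for k >= A theta, where the bias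
   is then at most 32 K^2 S / k^2 by the choice of C1, while for k < A theta
   it is at most 32 K^2 S <= 32 K^2 S (A theta / k)^2. *)

(** * Truncation *)

(** The obstacle is that [lamt k] depends on all earlier samples, so that the summands are neither
    independent nor bounded by a deterministic constant. No conditional expectation is formed: each
    factor is written as a function of two copies of the outcome, one carrying the past and one the
    present, and independence replaces the integral along the diagonal by an iterated one in which
    the past copy, hence the level, is frozen. The bias is subtracted inside the exponent, as a
    function of the random level, because it is only controlled afterwards, on an event about the
    sample means. That control rests on E |X_i| >= c sqrt S for the coordinate of largest variance
    S, with c = 1 / (32 K^2); both [C1] and A are multiples of a power of 1 / c. The power 3/2 of
    theta arises as sqrt theta from the concentration of the sum, times theta from the square of the
    truncation level. The case S = 0 is treated apart, since t and the truncation level, by which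
    the argument divides, would vanish. *)

Lemma expR_le_idD_expR_sqr (R : realType) (x : R) :
  expR x <= x + expR (2 * x ^+ 2).
Proof.
have e1 (y : R) : 1 + y <= expR y by exact: expR_ge1Dx.
have [x2|x2] := leP 2^-1 x.
  have : expR x <= expR (2 * x ^+ 2) by rewrite ler_expR; nra.
  lra.
have e2 : 1 + 2 * x ^+ 2 <= expR (2 * x ^+ 2) by exact: e1.
(* For x < 1/2 this gives exp x <= 1 / (1 - x), while (1 - x) (1 + x + 2 x^2) = 1 + x^2 (1 - 2 x) >=
   1. *)
have e3 : 1 - x <= expR (- x) by exact: e1.
have e4 : expR x * expR (- x) = 1 by rewrite -expRD subrr expR0.
have e5 : 0 < expR x := expR_gt0 x.
have e6 : (1 - x) * expR x <= 1 by rewrite -[leRHS]e4 mulrC ler_wpM2l// ltW.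
have [x0|x0] := leP 0 x; last by have : 1 <= (1 - x) * (1 + x + x ^+ 2 * 2); nra.
suff : (1 - x) * expR x <= (1 - x) * (1 + x + 2 * x ^+ 2).
  rewrite ler_pM2l; lra.
nra.
Qed.

(** Half of the exponent x^2 / t^2 absorbs the factor x^2, through u <= exp u at u = x^2 / (2 t^2);
    the other half is at least l^2 / (2 t^2) and supplies the decay in l. *)
Lemma sqr_tail_le (R : realType) (t l x : R) : 0 < t -> 0 <= l -> l < `|x| ->
  x ^+ 2 <= 2 * t ^+ 2 * expR (- (l ^+ 2 / (2 * t ^+ 2))) *
            expR (x ^+ 2 / t ^+ 2).
Proof.
move=> t0 l0 lx.
have t20 : 0 < 2 * t ^+ 2 by rewrite mulr_gt0// exprn_gt0.
rewrite -mulrA -expRD -ler_pdivrMl//.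
set u := (2 * t ^+ 2)^-1 * x ^+ 2.
have -> : - (l ^+ 2 / (2 * t ^+ 2)) + x ^+ 2 / t ^+ 2 =
    u + (2 * t ^+ 2)^-1 * (x ^+ 2 - l ^+ 2).
  by rewrite /u; field; rewrite gt_eqF.
have h : 0 <= (2 * t ^+ 2)^-1 * (x ^+ 2 - l ^+ 2).
  rewrite mulr_ge0 ?invr_ge0 ?(ltW t20)// subr_ge0 -(real_normK (num_real x)).
  by rewrite ler_pXn2r ?nnegrE ?normr_ge0//; exact: ltW.
have := expR_ge1Dx u.
suff : expR u <= expR (u + (2 * t ^+ 2)^-1 * (x ^+ 2 - l ^+ 2)) by lra.
by rewrite ler_expR lerDl.
Qed.

Definition clip (R : realType) (l x : R) : R := Num.max (- l) (Num.min l x).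

Lemma clip_id (R : realType) (l x : R) : `|x| <= l -> clip l x = x.
Proof.
rewrite ler_norml => /andP[? ?]; rewrite /clip.
by rewrite (min_idPr _)// (max_idPr _).
Qed.

Lemma normr_clip_le (R : realType) (l x : R) : 0 <= l -> `|clip l x| <= l.
Proof.
move=> l0; rewrite /clip ler_norml le_max lexx/= ge_max ge_min lexx/= andbT.
lra.
Qed.

Lemma clipE_scale (R : realType) (l x : R) : 0 <= l ->
  exists a, 0 <= a <= 1 /\ clip l x = a * x.
Proof.
move=> l0; have [xl|lx] := leP `|x| l.
  by exists 1; rewrite clip_id// mul1r ler01 lexx.
have x0 : 0 < `|x| by exact: le_lt_trans lx.
exists (l / `|x|); split.
  by rewrite divr_ge0// ler_pdivrMr// mul1r ltW.
rewrite /clip; have [x0'|x0'] := ltP 0 x.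
  rewrite gtr0_norm// in lx *.
  by rewrite mulfVK ?gt_eqF// (min_idPl (ltW lx)) max_r//; lra.
have {}x0' : x < 0 by rewrite lt_neqAle x0' -normr_gt0 x0.
rewrite ltr0_norm// in lx *.
rewrite invrN mulrN mulNr mulfVK ?lt_eqF//.
rewrite min_r; last by lra.
by rewrite max_l//; lra.
Qed.

(** The error is (1 - a b) x y up to sign, with a and b in [0, 1], hence at most |x| |y|. It
    vanishes unless one modulus exceeds l; then the larger modulus does, and its square dominates
    the product. *)
Lemma clip_prod_near (R : realType) (t l x y : R) : 0 < t -> 0 <= l ->
  `|clip l x * clip l y - x * y| <=
  2 * t ^+ 2 * expR (- (l ^+ 2 / (2 * t ^+ 2))) *
    (expR (x ^+ 2 / t ^+ 2) + expR (y ^+ 2 / t ^+ 2)).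
Proof.
move=> t0 l0; set c := 2 * t ^+ 2 * _.
have c0 : 0 <= c by rewrite mulr_ge0 ?expR_ge0// mulr_ge0 ?sqr_ge0//.
have [ex ey] : 0 <= c * expR (x ^+ 2 / t ^+ 2) /\ 0 <= c * expR (y ^+ 2 / t ^+ 2).
  by split; rewrite mulr_ge0 ?expR_ge0.
have [/andP[xl yl]|] := boolP ((`|x| <= l) && (`|y| <= l)).
  by rewrite !clip_id// subrr normr0 mulrDr addr_ge0.
have [a [/andP[a0 a1] ->]] := clipE_scale x l0.
have [b [/andP[b0 b1] ->]] := clipE_scale y l0.
have -> : a * x * (b * y) - x * y = - ((1 - a * b) * (x * y)) by ring.
have ab1 : 0 <= 1 - a * b <= 1 by nra.
have h : `|- ((1 - a * b) * (x * y))| <= `|x| * `|y|.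
  rewrite normrN 2!normrM ger0_norm; last by case/andP: ab1.
  by rewrite ler_piMl ?mulr_ge0//; case/andP: ab1.
rewrite negb_and -!ltNge => lxy; apply: (le_trans h).
have [xy|/ltW yx] := leP `|x| `|y|.
  have ly : l < `|y| by case/orP: lxy => // /lt_le_trans; apply.
  have := sqr_tail_le t0 l0 ly; rewrite -/c -(real_normK (num_real y)) => hy.
  have : `|x| * `|y| <= `|y| ^+ 2 by rewrite expr2 ler_wpM2r.
  by rewrite -(real_normK (num_real y)) in ey; lra.
have lx : l < `|x| by case/orP: lxy => // /lt_le_trans; apply.
have := sqr_tail_le t0 l0 lx; rewrite -/c -(real_normK (num_real x)) => hx.
have : `|x| * `|y| <= `|x| ^+ 2 by rewrite expr2 ler_wpM2l.
by rewrite -(real_normK (num_real x)) in ex; lra.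
Qed.

(** * Decoupling of independent maps *)

Definition pack_mfun d1 d2 (T1 : sigmaRingType d1) (T2 : sigmaRingType d2)
    (f : T1 -> T2) (mf : measurable_fun setT f) : {mfun T1 >-> T2} :=
  HB.pack f (@isMeasurableFun.Build _ _ _ _ f mf).

Section bounded_expectation.
Context d (T : measurableType d) (R : realType) (P : probability T R).

Lemma bounded_integrable (f : T -> R) (c : R) : measurable_fun setT f ->
  (forall w, `|f w| <= c) -> P.-integrable setT (EFin \o f).
Proof.
move=> mf fc; apply: (@le_integrable _ _ _ P _ measurableT _ (cst c%:E)).
- exact/measurable_EFinP.
- by move=> w _ /=; rewrite lee_fin (le_trans (fc w))// ler_norm.
- exact: finite_measure_integrable_cst.
Qed.

Lemma Rintegral_cst1 (r : R) : \int[P]_(_ in setT) r = r.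
Proof. by rewrite Rintegral_cst//= probability_setT mulr1. Qed.

Lemma Rintegral_EFin (f : T -> R) : P.-integrable setT (EFin \o f) ->
  (\int[P]_w (f w)%:E = (\int[P]_w f w)%:E)%E.
Proof. by move=> fi; rewrite /Rintegral fineK//; exact: integrable_fin_num. Qed.

Lemma normr_Rintegral_le (f : T -> R) (c : R) : measurable_fun setT f ->
  (forall w, `|f w| <= c) -> `|\int[P]_w f w| <= c.
Proof.
move=> mf fc; apply: (le_trans (le_normr_Rintegral _ _)) => //.
  exact: bounded_integrable fc.
rewrite -[leRHS]Rintegral_cst1; apply: le_Rintegral => //.
- apply: (@bounded_integrable _ c) => [|w]; last by rewrite normr_id.
  exact: measurableT_comp.
- exact: finite_measure_integrable_cst.
Qed.

Lemma markov_le (f : T -> R) (a c : R) : measurable_fun setT f ->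
  P.-integrable setT (EFin \o f) -> (forall w, 0 <= f w) -> 0 < a ->
  \int[P]_w f w <= c -> (P [set w | a <= f w]%R <= (c / a)%:E)%E.
Proof.
move=> mf fi f0 a0 fc.
have mA : measurable [set w | a <= f w]%R.
  by rewrite -[X in measurable X]setTI; exact: measurable_fun_le.
rewrite -(@lee_pmul2l _ a%:E)// -EFinM mulrC divfK ?gt_eqF//.
have h : (\int[P]_w (f w)%:E <= c%:E)%E by rewrite Rintegral_EFin// lee_fin.
apply: le_trans h.
rewrite -integral_cst//=.
apply: (@le_trans _ _ (\int[P]_(w in [set w | a <= f w]%R) (f w)%:E)%E).
  apply: ge0_le_integral => //=.
  - by move=> w _; rewrite lee_fin ltW.
  - by apply/measurable_EFinP; exact: measurable_funTS.
apply: ge0_subset_integral => //=; first exact/measurable_EFinP.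
by move=> w _; rewrite lee_fin.
Qed.

End bounded_expectation.

Section decoupling.
Context d (T : measurableType d) (R : realType) (P : probability T R).
Context d1 d2 (S1 : measurableType d1) (S2 : measurableType d2).
Variables (Y : {mfun T >-> S1}) (Z : {mfun T >-> S2}).
Hypothesis YZ : forall A B, measurable A -> measurable B ->
  P (Y @^-1` A `&` Z @^-1` B) = (P (Y @^-1` A) * P (Z @^-1` B))%E.

Let YZf w := (Y w, Z w).

Let mYZf : measurable_fun setT YZf.
Proof. exact: measurable_fun_pair. Qed.

Let mYZ : {mfun T >-> (S1 * S2)%type} := pack_mfun mYZf.

Lemma indep_joint_law C : measurable C ->
  (distribution P Y \x distribution P Z)%E C = distribution P mYZ C.
Proof.
by move=> mC; apply: product_measure_unique => // A B mA mB; rewrite /distribution /pushforward -YZ.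
Qed.

Variables (f : S1 * S2 -> R) (c : R).
Hypotheses (mf : measurable_fun setT f) (fc : forall z, `|f z| <= c).

Let fi : (distribution P Y \x distribution P Z)%E.-integrable setT (EFin \o f).
Proof.
apply: (@le_integrable _ _ _ _ _ measurableT _ (cst c%:E)).
- exact/measurable_EFinP.
- by move=> w _ /=; rewrite lee_fin (le_trans (fc w))// ler_norm.
- apply/integrableP; split => //.
  have h1 : ((distribution P Y \x distribution P Z) setT = 1)%E.
    by rewrite indep_joint_law//; exact: probability_setT.
  rewrite [X in (X < _)%E](_ : _ = (`|c|)%:E) ?ltry//.
  by rewrite (@integral_cst _ _ _ _ _ measurableT (`|c|)%:E) [X in (_ * X)%E]h1 mule1.
Qed.

Let mY : measurable_fun setT Y. Proof. exact: measurable_funPT. Qed.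

Let mZ : measurable_fun setT Z. Proof. exact: measurable_funPT. Qed.

Let mf1 y : measurable_fun setT (fun z => f (y, z)).
Proof. exact: measurableT_comp. Qed.

Let fubini_FE :
  fubini_F (distribution P Z) (EFin \o f) = EFin \o (fun y => \int[P]_w f (y, Z w)).
Proof.
apply/funext => y; rewrite /fubini_F /= -Rintegral_EFin.
  rewrite integral_distribution//; first exact/measurable_EFinP.
  by apply: (@bounded_integrable _ _ _ _ (fun w => f (y, Z w)) c) => //; exact: measurableT_comp (mf1 y) mZ.
by apply: (@bounded_integrable _ _ _ _ (fun w => f (y, Z w)) c) => //; exact: measurableT_comp (mf1 y) mZ.
Qed.

Lemma decouple_measurable :
  measurable_fun setT (fun y => \int[P]_w f (y, Z w)).
Proof. by apply/measurable_EFinP; rewrite -fubini_FE; exact: measurable_fubini_F fi. Qed.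

(** The joint law is the product law, so Fubini applies. The inner integral, in which the first
    argument is frozen, takes the place of the conditional expectation given [Y]. *)
Lemma decouple : \int[P]_w f (Y w, Z w) = \int[P]_w \int[P]_w' f (Y w, Z w').
Proof.
rewrite /Rintegral; congr fine.
transitivity (\int[distribution P mYZ]_z (f z)%:E)%E.
  rewrite integral_distribution//; first exact/measurable_EFinP.
  by apply: (@bounded_integrable _ _ _ _ (fun w => f (Y w, Z w)) c) => //; exact: measurableT_comp mf mYZf.
transitivity (\int[(distribution P Y \x distribution P Z)%E]_z (f z)%:E)%E.
  by apply: eq_measure_integral => A mA _; exact/esym/indep_joint_law.
rewrite -(integral12_prod_meas1 fi) fubini_FE.
have mF := decouple_measurable.
rewrite integral_distribution//; first exact/measurable_EFinP.
apply: (@bounded_integrable _ _ _ _ (fun w => \int[P]_w' f (Y w, Z w')) c) => //.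
  exact: measurableT_comp mF mY.
by move=> w; apply: normr_Rintegral_le => //; exact: measurableT_comp (mf1 _) mZ.
Qed.

End decoupling.

(** * Independence of the sigma-algebras generated by disjoint subfamilies *)

Section cylinders.
Context d (T : measurableType d) (R : realType) (P : probability T R).
Context (p : nat) (I : finType) (F : I -> {RV P >-> p.-tuple R}).

(* A pi-system generating the sigma-algebra of the [F i] with [J i].  Equipping
   [T] itself with that sigma-algebra spares the product of the codomains. *)
Definition cylinders (J : pred I) : set (set T) :=
  [set A | exists B : I -> set (p.-tuple R),
    [/\ forall i, measurable (B i), forall i, ~~ J i -> B i = setT &
        A = \bigcap_i (F i @^-1` B i)]].

Local Notation sub_space J := (g_sigma_algebraType (cylinders J)).

Lemma cylinders_setI J : setI_closed (cylinders J).
Proof.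
move=> _ _ [B [mB BT ->]] [C [mC CT ->]].
exists (fun i => B i `&` C i); split.
- by move=> i; exact: measurableI.
- by move=> i Ji; rewrite BT// CT// setIT.
- by rewrite -bigcapI; apply: eq_bigcapr => i _; rewrite preimage_setI.
Qed.

Lemma cylinders_setT J : cylinders J setT.
Proof.
exists (fun=> setT); split => //.
by apply/esym/seteqP; split.
Qed.

Lemma cylinders_measurable J : cylinders J `<=` measurable.
Proof.
move=> _ [B [mB BT ->]]; apply: fin_bigcap_measurable => // i _.
by rewrite -[X in measurable X]setTI; exact: measurable_funPT.
Qed.

Lemma cylindersS (J J' : pred I) : {subset J <= J'} ->
  cylinders J `<=` cylinders J'.
Proof.
move=> JJ' A [B [mB BT ->]]; exists B; split => // i J'i; apply: BT.
by apply: contra J'i => Ji; exact: (JJ' i).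
Qed.

Lemma sub_space_id_measurable (J : pred I) :
  measurable_fun setT (id : T -> sub_space J).
Proof.
move=> _ A sA; rewrite setTI preimage_id.
have : <<s cylinders J >> `<=` @measurable _ T.
  by apply: smallest_sub; [exact: sigma_algebra_measurable|exact: cylinders_measurable].
exact.
Qed.

Lemma sub_space_idS (J J' : pred I) : {subset J <= J'} ->
  measurable_fun setT (id : sub_space J' -> sub_space J).
Proof.
move=> JJ' _ A sA; rewrite setTI preimage_id.
have : <<s cylinders J >> `<=` <<s cylinders J' >>.
  apply: smallest_sub; first exact: smallest_sigma_algebra.
  by move=> B /(cylindersS JJ'); exact: sub_sigma_algebra.
exact.
Qed.

Lemma sub_space_coord_measurable (J : pred I) i : J i ->
  measurable_fun setT (F i : sub_space J -> p.-tuple R).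
Proof.
move=> Ji _ A mA; rewrite setTI; apply: sub_sigma_algebra.
exists (fun j => if j == i then A else setT); split.
- by move=> j; case: ifP.
- by move=> j; case: eqP => // ->; rewrite Ji.
- apply/seteqP; split=> [w Aw j _|w /(_ i Logic.I)]; last by rewrite /= eqxx.
  by rewrite /=; case: eqP => // ->.
Qed.

Definition to_sub_space (J : pred I) : {mfun T >-> sub_space J} :=
  pack_mfun (@sub_space_id_measurable J).

Hypothesis indF : mutually_independent F.

Lemma cylinders_indep (J J' : pred I) A A' : (forall i, ~~ (J i && J' i)) ->
  cylinders J A -> cylinders J' A' -> (P (A `&` A') = P A * P A')%E.
Proof.
move=> JJ' [B [mB BT ->]] [C [mC CT ->]].
have -> : \bigcap_i (F i @^-1` B i) `&` \bigcap_i (F i @^-1` C i) =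
    \bigcap_i (F i @^-1` (B i `&` C i)).
  by rewrite -bigcapI; apply: eq_bigcapr => i _; rewrite preimage_setI.
rewrite !indF//; last by move=> i; exact: measurableI.
rewrite -big_split/=; apply: eq_bigr => i _.
have := JJ' i; rewrite negb_and => /orP[/BT|/CT] ->.
  by rewrite setTI preimage_setT probability_setT mul1e.
by rewrite setIT preimage_setT probability_setT mule1.
Qed.

(** The pi-lambda uniqueness theorem is applied twice: for a fixed event E, the measure of the
    intersection with E and the multiple of [P] by the mass of E are finite measures that agree on
    the cylinders, hence on the sigma-algebra they generate. E is an arbitrary event of the second
    sigma-algebra in the first application and a cylinder of the first one in the other. *)
Lemma sub_space_indep (J J' : pred I) A A' : (forall i, ~~ (J i && J' i)) ->
  <<s cylinders J >> A -> <<s cylinders J' >> A' -> (P (A `&` A') = P A * P A')%E.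
Proof.
move=> JJ'.
have mcyl (K : pred I) X : <<s cylinders K >> X -> measurable X.
  by move=> /(@sub_space_id_measurable K measurableT); rewrite setTI preimage_id.
have step (K : pred I) (E : set T) (mE : measurable E) :
    (forall X, cylinders K X -> P (X `&` E) = P X * P E)%E ->
    forall X, <<s cylinders K >> X -> (P (X `&` E) = P X * P E)%E.
  move=> h X sX.
  have PE : (P E = (fine (P E))%:E)%E by rewrite fineK// fin_num_measure.
  have PE0 : 0 <= fine (P E) by exact: fine_ge0.
  have := @g_sigma_algebra_measure_unique _ _ _ (cylinders K)
    (@cylinders_measurable K) (fun=> setT) (fun=> @cylinders_setT K) _
    (mrestr P mE) (mscale (NngNum PE0) P) (@cylinders_setI K) _ _ X sX.
  have hh Y : mscale (NngNum PE0) P Y = (P Y * P E)%E.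
    by rewrite /mscale muleC; congr (_ * _)%E; exact/esym.
  move=> uniq; apply: (etrans _ (hh X)); apply: uniq.
  - by rewrite bigcup_const.
  - by move=> Y cY; apply: (etrans _ (esym (hh Y))); exact: h.
  - by move=> _; rewrite /= /mrestr setTI ltey_eq fin_num_measure.
move=> sA sA'; apply: (step J) => //; first exact: mcyl sA'.
move=> X cX; rewrite setIC muleC; apply: (step J') => //.
  exact: cylinders_measurable cX.
move=> Y cY; rewrite setIC muleC; exact: (cylinders_indep JJ').
Qed.

(** Both maps are the identity of [T], seen as a map to [T] with a coarser sigma-algebra;
    measurability of [f] for these says that its two arguments only see the subfamilies [J] and
    [J']. *)
Lemma sub_space_decouple (J J' : pred I)
    (f : (sub_space J * sub_space J')%type -> R) (c : R) :
  (forall i, ~~ (J i && J' i)) -> measurable_fun setT f ->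
  (forall z, `|f z| <= c) ->
  \int[P]_w f (w, w) = \int[P]_w \int[P]_w' f (w, w').
Proof.
move=> JJ' mf fc.
by apply: (@decouple _ _ _ P _ _ _ _ (to_sub_space J) (to_sub_space J') _ f c) => // A B mA mB; exact: (sub_space_indep JJ').
Qed.

Lemma sub_space_decouple_measurable (J J' : pred I)
    (f : (sub_space J * sub_space J')%type -> R) (c : R) :
  (forall i, ~~ (J i && J' i)) -> measurable_fun setT f ->
  (forall z, `|f z| <= c) ->
  measurable_fun setT (fun w : sub_space J => \int[P]_w' f (w, w')).
Proof.
move=> JJ' mf fc.
by apply: (@decouple_measurable _ _ _ P _ _ _ _ (to_sub_space J) (to_sub_space J') _ f c) => // A B mA mB; exact: (sub_space_indep JJ').
Qed.

Variable time : I -> nat.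

Definition past (k : nat) : pred I := fun s => (time s < k)%N.
Definition present (k : nat) : pred I := fun s => time s == k.

(* Supermartingale bound: the first argument of [h k] carries the past and the
   second one the present, so that the factors can be integrated out one at a
   time, the last one first. *)
Lemma Rintegral_prod_le (h : nat -> T * T -> R) (b c : nat -> R) (N : nat) :
  (forall k, measurable_fun setT
    (h k : (sub_space (past k) * sub_space (present k))%type -> R)) ->
  (forall k z, 0 <= h k z <= b k) ->
  (forall k w, \int[P]_w' h k (w, w') <= c k) ->
  \int[P]_w \prod_(0 <= k < N) h k (w, w) <= \prod_(0 <= k < N) c k.
Proof.
move=> mh hb hc.
have h0 k z : 0 <= h k z by case/andP: (hb k z).
have prod_bnd m w : 0 <= \prod_(0 <= k < m) h k (w, w) <= \prod_(0 <= k < m) b k.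
  rewrite prodr_ge0//=; apply: ler_prod => // k _; exact: hb.
(* A factor of index i < m involves times up to i only, so this product belongs to the past of m. *)
have mprod m : measurable_fun setT
    (fun w : sub_space (past m) => \prod_(0 <= k < m) h k (w, w)).
  rewrite (_ : (fun w => _) = (fun w => \prod_(i < m) h i (w, w))); last first.
    by apply/funext => w; rewrite big_mkord.
  apply: measurable_prod => i _.
  suff mp : measurable_fun setT (fun w : sub_space (past m) =>
      ((w, w) : (sub_space (past i) * sub_space (present i))%type)).
    exact: measurableT_comp (mh i) mp.
  apply: measurable_fun_pair; apply: sub_space_idS => s; rewrite !unfold_in /=.
    by move=> /ltn_trans; apply.
  by move=> /eqP ->.
have mdiag k : measurable_fun setT (fun w : T => h k (w, w)).
  suff mp : measurable_fun setT (fun w : T =>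
      ((w, w) : (sub_space (past k) * sub_space (present k))%type)).
    exact: measurableT_comp (mh k) mp.
  by apply: measurable_fun_pair; exact: sub_space_id_measurable.
have m2 k w : measurable_fun setT (fun w' : T => h k (w, w')).
  suff mp : measurable_fun setT (fun w' : T =>
      ((w, w') : (sub_space (past k) * sub_space (present k))%type)).
    exact: measurableT_comp (mh k) mp.
  apply: measurable_fun_pair; last exact: sub_space_id_measurable.
  exact: measurable_cst.
have i2 k w : P.-integrable setT (EFin \o (fun w' : T => h k (w, w'))).
  apply: (@bounded_integrable _ _ _ P _ (b k)) => // w'.
  by rewrite ger0_norm//; case/andP: (hb k (w, w')).
elim: N => [|N IH].
  by under eq_Rintegral do rewrite big_nil; rewrite big_nil Rintegral_cst1.
(* All earlier factors are read off the past copy, so that decoupling integrates the last one over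
   the present with the others frozen. *)
pose f (z : sub_space (past N) * sub_space (present N)) :=
  (\prod_(0 <= k < N) h k (z.1, z.1)) * h N z.
have b0 k : 0 <= b k by case/andP: (hb k (point, point)) => /le_trans; apply.
have fb z : `|f z| <= \prod_(0 <= k < N) b k * b N.
  rewrite ger0_norm; last by rewrite mulr_ge0// prodr_ge0.
  by apply: ler_pM => //; [rewrite prodr_ge0|case/andP: (prod_bnd N z.1)|case/andP: (hb N z)].
have mf : measurable_fun setT f.
  apply: measurable_funM; last exact: mh.
  by apply: (measurableT_comp (mprod N)); exact: measurable_fst.
have disj i : ~~ (past N i && present N i).
  by rewrite /past /present; case: ltngtP.
have -> : \int[P]_w \prod_(0 <= k < N.+1) h k (w, w) = \int[P]_w f (w, w).
  by apply: eq_Rintegral => w _; rewrite big_nat_recr.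
rewrite (sub_space_decouple disj mf fb).
have mG := measurableT_comp (mprod N) (@sub_space_id_measurable (past N)).
have iG : P.-integrable setT (EFin \o (fun w => \prod_(0 <= k < N) h k (w, w))).
  apply: (@bounded_integrable _ _ _ P _ (\prod_(0 <= k < N) b k)) => // w.
  by rewrite ger0_norm; case/andP: (prod_bnd N w).
have c0 : 0 <= c N by apply: le_trans (hc N point); apply: Rintegral_ge0.
apply: (@le_trans _ _ (\int[P]_w (\prod_(0 <= k < N) h k (w, w) * c N))).
  apply: le_Rintegral => //.
  - apply: (@bounded_integrable _ _ _ P _ (\prod_(0 <= k < N) b k * b N)).
      have := sub_space_decouple_measurable disj mf fb.
      by move=> /measurableT_comp /(_ (@sub_space_id_measurable (past N))).
    move=> w; apply: normr_Rintegral_le => //.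
    by rewrite /f/=; apply: measurable_funM => //; exact: measurable_cst.
  - apply: (@bounded_integrable _ _ _ P _ (\prod_(0 <= k < N) b k * c N)).
      by apply: measurable_funM => //; exact: measurable_cst.
    move=> w; rewrite ger0_norm; last by rewrite mulr_ge0// prodr_ge0.
    by rewrite ler_wpM2r//; case/andP: (prod_bnd N w).
  - move=> w _; rewrite /f/= RintegralZl// ler_wpM2l// prodr_ge0//.
rewrite RintegralZr// big_nat_recr//= ler_wpM2r//.
Qed.

End cylinders.

(** * Subgaussian variables and dithers *)

Section psi2_bound.
Context d (T : measurableType d) (R : realType) (P : probability T R).
Implicit Types (x y : T -> R) (t : R).

(** For t > 0 this expresses that the psi_2 norm is at most t. Integrability is stated separately
    because the real-valued integral takes the value 0 when the integral is infinite, which would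
    satisfy the last bound. *)
Definition psi2_bound x t :=
  [/\ measurable_fun setT x,
      P.-integrable setT (fun w => (expR (x w ^+ 2 / t ^+ 2))%:E) &
      \int[P]_w expR (x w ^+ 2 / t ^+ 2) <= 2].

Lemma psi2_bound_tail x t a : 0 < t -> 0 <= a -> psi2_bound x t ->
  (P [set w | a <= `|x w|]%R <= (2 * expR (- (a ^+ 2 / t ^+ 2)))%:E)%E.
Proof.
move=> t0 a0 [mx ix x2]; rewrite expRN.
have mexp := measurable_int _ ix; move/measurable_EFinP in mexp.
have := @markov_le _ _ _ P _ (expR (a ^+ 2 / t ^+ 2)) _ mexp ix (fun=> expR_ge0 _) (expR_gt0 _) x2.
rewrite (_ : [set w | _] = [set w | a <= `|x w|]%R)//.
apply/seteqP; split=> w /=; rewrite ler_expR ler_pM2r ?invr_gt0 ?exprn_gt0//;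
  by rewrite -[x w ^+ 2]real_normK ?num_real// ler_pXn2r ?nnegrE.
Qed.

Lemma psi2_bound_prod_integrable x y t : 0 < t -> psi2_bound x t ->
  psi2_bound y t -> P.-integrable setT (fun w => (x w * y w)%:E).
Proof.
move=> t0 [mx ix _] [my iy _].
apply: (@le_integrable _ _ _ P _ measurableT _ (fun w => (t ^+ 2 * (expR (x w ^+ 2 / t ^+ 2) + expR (y w ^+ 2 / t ^+ 2)))%:E)).
- by apply/measurable_EFinP; exact: measurable_funM.
- move=> w _ /=; rewrite lee_fin.
  have t2 : 0 < t ^+ 2 by rewrite exprn_gt0.
  have e1 (u : R) : u ^+ 2 <= t ^+ 2 * expR (u ^+ 2 / t ^+ 2).
    rewrite -ler_pdivrMl// mulrC; apply: le_trans (expR_ge1Dx _); lra.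
  rewrite [leRHS]ger0_norm; last by rewrite mulr_ge0 ?addr_ge0 ?expR_ge0 ?ltW.
  rewrite mulrDr; have := e1 (x w); have := e1 (y w).
  rewrite normrM -(real_normK (num_real (x w))) -(real_normK (num_real (y w))).
  have := normr_ge0 (x w); have := normr_ge0 (y w).
  move: `|x w| `|y w| => u v; nra.
- have := integrableD measurableT ix iy => /(integrableZl measurableT (t ^+ 2)).
  by apply: eq_integrable => // w _ /=; rewrite EFinM EFinD.
Qed.

Lemma clip_measurable l d' (T' : measurableType d') (x : T' -> R) :
  measurable_fun setT x -> measurable_fun setT (fun w => clip l (x w)).
Proof.
move=> mx; rewrite /clip; apply: measurable_maxr => //.
by apply: measurable_minr.
Qed.

(** [clip_prod_near] is integrated; each of the two exponential moments is at most 2, whence 8 = 2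
    (2 + 2). *)
Lemma psi2_bound_clip_prod x y t l : 0 < t -> 0 <= l -> psi2_bound x t ->
  psi2_bound y t ->
  `|\int[P]_w (clip l (x w) * clip l (y w)) - \int[P]_w (x w * y w)| <=
  8 * t ^+ 2 * expR (- (l ^+ 2 / (2 * t ^+ 2))).
Proof.
move=> t0 l0 hx hy; have ixy := psi2_bound_prod_integrable t0 hx hy.
case: hx hy => mx ix ex [my iy ey].
have icc : P.-integrable setT (EFin \o (fun w => clip l (x w) * clip l (y w))).
  apply: (@bounded_integrable _ _ _ P _ (l * l)) => [|w].
    by apply: measurable_funM; exact: clip_measurable.
  by rewrite normrM ler_pM// normr_clip_le.
rewrite -RintegralB//; apply: (le_trans (le_normr_Rintegral _ _)) => //.
  by have := integrableB measurableT icc ixy; apply: eq_integrable.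
set c := 2 * t ^+ 2 * expR (- (l ^+ 2 / (2 * t ^+ 2))).
have c0 : 0 <= c by rewrite mulr_ge0 ?expR_ge0// mulr_ge0 ?sqr_ge0.
have iD := integrableD measurableT ix iy.
have iS : P.-integrable setT (fun w => (c * (expR (x w ^+ 2 / t ^+ 2) + expR (y w ^+ 2 / t ^+ 2)))%:E).
  have := integrableZl measurableT c iD.
  by apply: eq_integrable => // w _ /=; rewrite EFinM EFinD.
apply: (@le_trans _ _ (\int[P]_w (c * (expR (x w ^+ 2 / t ^+ 2) + expR (y w ^+ 2 / t ^+ 2))))).
  apply: le_Rintegral => //.
    have /integrable_abse := integrableB measurableT icc ixy.
    by apply: eq_integrable.
  by move=> w _; exact: clip_prod_near.
rewrite RintegralZl//; rewrite RintegralD//.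
have : c * 4 = 8 * t ^+ 2 * expR (- (l ^+ 2 / (2 * t ^+ 2))) by rewrite /c; ring.
nra.
Qed.

Lemma psi2_bound_normr_integrable x t : 0 < t -> psi2_bound x t ->
  P.-integrable setT (fun w => `|x w|%:E).
Proof.
move=> t0 hx; have ixx := psi2_bound_prod_integrable t0 hx hx.
case: hx => mx ix ex.
apply: (@le_integrable _ _ _ P _ measurableT _ (fun w => (1 + x w * x w)%:E)).
- by apply/measurable_EFinP; exact: measurableT_comp.
- move=> w _ /=; rewrite lee_fin normr_id [leRHS]ger0_norm; last by nra.
  have : x w * x w = `|x w| ^+ 2 by rewrite real_normK ?num_real// expr2.
  move: `|x w| => u ->; nra.
- have i1 : P.-integrable setT (EFin \o cst (1 : R)).
    exact: finite_measure_integrable_cst.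
  by have := integrableD measurableT i1 ixx; apply: eq_integrable.
Qed.

(** L1 and L2 norms are comparable for subgaussian variables: x^2 <= l |x| where |x| <= l, and for a
    suitable l the part where |x| > l contributes at most sigma^2 / 2 to the second moment, so l E
    |x| >= sigma^2 / 2. *)
Lemma psi2_bound_L1_ge x (K sigma : R) : 0 < K -> 0 < sigma ->
  psi2_bound x (2 * K * sigma) -> \int[P]_w (x w * x w) = sigma ^+ 2 ->
  sigma / (32 * K ^+ 2) <= \int[P]_w `|x w|.
Proof.
move=> K0 s0 hx x2; set t := 2 * K * sigma.
have t0 : 0 < t by rewrite !mulr_gt0.
have ixx := psi2_bound_prod_integrable t0 hx hx.
have iax := psi2_bound_normr_integrable t0 hx.
case: hx => mx ix ex.
(* At this level l^2 / (2 t^2) = 32 K^2, so the tail part is at most 16 K^2 sigma^2 exp (- 32 K^2),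
   and exp a >= 1 + a bounds this by sigma^2 / 2. *)
set l := 16 * K ^+ 2 * sigma.
have l0 : 0 < l by rewrite !mulr_gt0// exprn_gt0.
set c := 2 * t ^+ 2 * expR (- (l ^+ 2 / (2 * t ^+ 2))).
have c0 : 0 <= c by rewrite mulr_ge0 ?expR_ge0// mulr_ge0 ?sqr_ge0.
have i1 : P.-integrable setT (fun w => (l * `|x w|)%:E).
  by have := integrableZl measurableT l iax; apply: eq_integrable.
have i2 : P.-integrable setT (fun w => (c * expR (x w ^+ 2 / t ^+ 2))%:E).
  by have := integrableZl measurableT c ix; apply: eq_integrable.
have : \int[P]_w (x w * x w) <= \int[P]_w (l * `|x w| + c * expR (x w ^+ 2 / t ^+ 2)).
  apply: le_Rintegral => //.
    by have := integrableD measurableT i1 i2; apply: eq_integrable.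
  move=> w _; rewrite -expr2; have [xl|lx] := leP `|x w| l.
    have : x w ^+ 2 <= l * `|x w|.
      by rewrite -(real_normK (num_real (x w))) expr2 ler_wpM2r.
    by have := mulr_ge0 c0 (expR_ge0 (x w ^+ 2 / t ^+ 2)); lra.
  have := sqr_tail_le t0 (ltW l0) lx; rewrite -/c.
  by have := mulr_ge0 (ltW l0) (normr_ge0 (x w)); lra.
rewrite RintegralD// !RintegralZl// x2 => h.
have ce : c * 2 <= sigma ^+ 2 / 2.
  have -> : c = 8 * K ^+ 2 * sigma ^+ 2 * expR (- (32 * K ^+ 2)).
    rewrite /c (_ : l ^+ 2 / (2 * t ^+ 2) = 32 * K ^+ 2).
      by rewrite /t; ring.
    by rewrite /l /t; field; rewrite !gt_eqF.
  have : (1 + 32 * K ^+ 2) * expR (- (32 * K ^+ 2)) <= 1.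
    rewrite expRN ler_pdivrMr ?expR_gt0// mul1r; exact: expR_ge1Dx.
  have := expR_gt0 (- (32 * K ^+ 2)); have : 0 < K ^+ 2 by rewrite exprn_gt0.
  have : 0 < sigma ^+ 2 by rewrite exprn_gt0.
  move: (expR (- (32 * K ^+ 2))) => e; move: (K ^+ 2) (sigma ^+ 2) => k s s0' k0 e0 he.
  have : k * e * 32 <= 1 by nra.
  nra.
have {}h : sigma ^+ 2 / 2 <= l * \int[P]_w `|x w|.
  have : c * \int[P]_w expR (x w ^+ 2 / t ^+ 2) <= c * 2 by rewrite ler_wpM2l.
  lra.
have -> : sigma / (32 * K ^+ 2) = l^-1 * (sigma ^+ 2 / 2).
  by rewrite /l; field; rewrite !gt_eqF.
by rewrite ler_pdivrMl.
Qed.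

(* exp (- u) <= 1 - u + u^2 for u >= 0. *)
Lemma psi2_bound_laplace x (K sigma c : R) : c = (32 * K ^+ 2)^-1 -> 0 < K -> 0 < sigma ->
  psi2_bound x (2 * K * sigma) -> \int[P]_w (x w * x w) = sigma ^+ 2 ->
  \int[P]_w expR (- (c / (2 * sigma) * `|x w|)) <= expR (- (c ^+ 2 / 4)).
Proof.
move=> cE K0 s0 hx x2; have := psi2_bound_L1_ge K0 s0 hx x2; rewrite -cE => hl.
have t0 : 0 < 2 * K * sigma by rewrite !mulr_gt0.
have ixx := psi2_bound_prod_integrable t0 hx hx.
have iax := psi2_bound_normr_integrable t0 hx.
case: hx => mx ix ex.
have c0 : 0 < c by rewrite cE invr_gt0 mulr_gt0// exprn_gt0.
(* The minimiser of the bound 1 - s c sigma + s^2 sigma^2 on the Laplace transform; the minimum is 1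
   - c^2 / 4. *)
set s := c / (2 * sigma); have s_ge0 : 0 < s by rewrite divr_gt0// mulr_gt0.
have i0 : P.-integrable setT (EFin \o cst (1 : R)).
  exact: finite_measure_integrable_cst.
have i1 : P.-integrable setT (fun w => (s * `|x w|)%:E).
  by have := integrableZl measurableT s iax; apply: eq_integrable.
have i2 : P.-integrable setT (fun w => (s ^+ 2 * (x w * x w))%:E).
  by have := integrableZl measurableT (s ^+ 2) ixx; apply: eq_integrable.
have i3 : P.-integrable setT (EFin \o (fun w => 1 - s * `|x w|)).
  by have := integrableB measurableT i0 i1; apply: eq_integrable.
have i4 : P.-integrable setT (EFin \o (fun w => (1 - s * `|x w|) + s ^+ 2 * (x w * x w))).
  by have := integrableD measurableT i3 i2; apply: eq_integrable.
apply: (@le_trans _ _ (\int[P]_w (1 - s * `|x w| + s ^+ 2 * (x w * x w)))).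
  apply: le_Rintegral => //.
    apply: (@bounded_integrable _ _ _ P _ 1) => [|w].
      apply: measurableT_comp => //; apply: measurableT_comp => //.
      by apply: measurable_funM => //; exact: measurableT_comp.
    rewrite ger0_norm ?expR_ge0// -expR0 ler_expR oppr_le0 mulr_ge0 ?(ltW s_ge0)//.
  move=> w _; rewrite -expr2 -(real_normK (num_real (x w))) -exprMn.
  have : 0 <= s * `|x w| by rewrite mulr_ge0 ?(ltW s_ge0).
  move: (s * _) => u u0.
  rewrite expRN -[leLHS]mul1r ler_pdivrMr ?expR_gt0//.
  have p0 : 0 <= 1 - u + u ^+ 2 by nra.
  apply: (le_trans _ (ler_wpM2l p0 (expR_ge1Dx u))).
  have -> : (1 - u + u ^+ 2) * (1 + u) = 1 + u ^+ 3 by ring.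
  by rewrite lerDl exprn_ge0.
rewrite RintegralD// RintegralB// !RintegralZl// Rintegral_cst1 x2.
apply: le_trans (expR_ge1Dx _).
have -> : s ^+ 2 * sigma ^+ 2 = c ^+ 2 / 4 by rewrite /s; field; rewrite gt_eqF.
have : s * (sigma * c) = c ^+ 2 / 2 by rewrite /s; field; rewrite gt_eqF.
have : s * (sigma * c) <= s * \int[P]_w `|x w| by rewrite ler_wpM2l// ltW.
lra.
Qed.

End psi2_bound.

(** * The mean of a dithered sign is a truncation *)

Lemma clip_oppr (R : realType) (l x : R) : 0 <= l -> clip l (- x) = - clip l x.
Proof.
move=> l0; rewrite /clip oppr_max opprK oppr_min max_minr.
by rewrite (@max_r _ _ (- l) l)//; lra.
Qed.

Lemma clip_homog (R : realType) (a l x : R) : 0 <= a ->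
  clip (a * l) (a * x) = a * clip l x.
Proof. by move=> a0; rewrite /clip -mulrN -minr_pMr// -maxr_pMr. Qed.

Lemma uniform_prob_itv_cy (R : realType) (a : R) :
  uniform_prob (@ltN11 R) `[a, +oo[%classic = ((1 - clip 1 a) / 2)%:E.
Proof.
rewrite /uniform_prob integral_uniform_pdf.
have cst12 (A : set R) : measurable A ->
    (\int[lebesgue_measure]_(x in (A `&` `[(-1)%R, 1%R]%classic)) (uniform_pdf (-1) 1 x)%:E =
     (2^-1)%:E * lebesgue_measure (A `&` `[(-1)%R, 1%R]%classic))%E.
  move=> mA; rewrite -integral_cst; last exact: measurableI.
  apply: eq_integral => x; rewrite inE /= in_itv/= => -[_ h].
  by rewrite /uniform_pdf h; congr (_%:E); congr (_^-1); lra.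
rewrite cst12//; have [a1|a1] := leP a (-1).
  have -> : `[a, +oo[%classic `&` `[(-1)%R, 1%R]%classic = `[(-1)%R, 1%R]%classic.
    by apply: setIidr => x /=; rewrite !in_itv/= => /andP[h _]; rewrite andbT; lra.
  rewrite lebesgue_measure_itv/= lte_fin (@ltN11 R) -EFinD -EFinM; congr _%:E.
  rewrite /clip min_r; last by lra.
  rewrite max_l; last by lra.
  lra.
have [a2|a2] := leP a 1.
  have -> : `[a, +oo[%classic `&` `[(-1)%R, 1%R]%classic = `[a, 1%R]%classic.
    apply/seteqP; split=> x /=; rewrite !in_itv/= andbT.
      by move=> [? /andP[? ?]]; apply/andP; split.
    by move=> /andP[? ?]; split => //; apply/andP; split => //; lra.
  rewrite clip_id; last by rewrite ler_norml; lra.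
  rewrite lebesgue_measure_itv/= lte_fin; case: ltP => a3.
    by rewrite -EFinD -EFinM mulrC.
  have -> : a = 1 by lra.
  by rewrite mule0 subrr mul0r.
have -> : `[a, +oo[%classic `&` `[(-1)%R, 1%R]%classic = set0.
  apply/seteqP; split=> x //=; rewrite !in_itv/= andbT => -[? /andP[? ?]]; lra.
rewrite measure0 mule0 /clip min_l ?max_r; [|lra|lra].
by rewrite subrr mul0r.
Qed.

Lemma measurable_sign1 (R : realType) : measurable_fun setT (@sign1 R).
Proof. by apply: measurable_fun_ifT => //; exact: measurable_fun_ler. Qed.

Lemma normr_sign1 (R : realType) (x : R) : `|sign1 x| = 1.
Proof. by rewrite /sign1; case: ifP; rewrite ?normrN normr1. Qed.

Section dither.
Context d (T : measurableType d) (R : realType) (P : probability T R).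

(** For l > 0 the sign is 1 exactly when u >= - x / l, so the integrand is affine in an indicator of
    probability (1 + clip 1 (x / l)) / 2. The case l = 0 does occur: the factor ln k of the squared
    level vanishes at k = 1. *)
Lemma Rintegral_sign1_dither (u : T -> R) (l x : R) :
  measurable_fun setT u ->
  (forall A, measurable A -> P (u @^-1` A) = uniform_prob (@ltN11 R) A) ->
  0 <= l -> \int[P]_w (l * sign1 (x + l * u w)) = clip l x.
Proof.
move=> mu lawu; rewrite le_eqVlt => /predU1P[<-|l0].
  under eq_Rintegral do rewrite mul0r.
  rewrite Rintegral_cst1; apply/esym/eqP; rewrite -normr_le0.
  exact: normr_clip_le.
pose A := u @^-1` `[- (x / l), +oo[%classic.
have mA : measurable A by rewrite -[A]setTI; exact: mu.
have -> : \int[P]_w (l * sign1 (x + l * u w)) =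
    \int[P]_w ((2 * l) * \1_A w - l).
  apply: eq_Rintegral => w _; rewrite /sign1 indicE /A.
  have -> : (0 <= x + l * u w) = (w \in u @^-1` `[- (x / l), +oo[%classic).
    have -> : (0 <= x + l * u w) = (- (x / l) <= u w).
      by rewrite -mulNr ler_pdivrMr// -[RHS]subr_ge0 opprK addrC mulrC.
    by apply/idP/idP => [h|/set_mem]; [apply/mem_set|]; rewrite /= in_itv/= andbT.
  by case: (w \in _); rewrite ?mulr1 ?mulr0; lra.
have iA : P.-integrable setT (EFin \o \1_A).
  apply: (@bounded_integrable _ _ _ P _ 1) => // w.
  by rewrite indicE; case: (_ \in _); rewrite ?normr1 ?normr0.
have i1 : P.-integrable setT (EFin \o (fun w => 2 * l * \1_A w)).
  by have := integrableZl measurableT (2 * l) iA; apply: eq_integrable.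
rewrite RintegralB//; last exact: finite_measure_integrable_cst.
rewrite RintegralZl// Rintegral_cst1.
rewrite {1}/Rintegral integral_indic// setIT.
rewrite [X in fine X](etrans (lawu `[- (x / l), +oo[%classic _) (uniform_prob_itv_cy _))//=.
rewrite clip_oppr ?ler01//.
have -> : clip l x = l * clip 1 (x / l).
  by rewrite -clip_homog ?(ltW l0)// mulr1 mulrC divfK ?gt_eqF.
by field.
Qed.

(* exp x <= x + exp (2 x^2), and the linear term integrates to 0. *)
Lemma mgf_le (f : T -> R) (B s m : R) : measurable_fun setT f ->
  (forall w, `|f w| <= B) -> \int[P]_w f w = m ->
  \int[P]_w expR (s * (f w - m)) <= expR (8 * s ^+ 2 * B ^+ 2).
Proof.
move=> mf fB fm.
have B0 : 0 <= B := le_trans (normr_ge0 _) (fB point).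
have mB : `|m| <= B by rewrite -fm; exact: normr_Rintegral_le.
have mg : measurable_fun setT (fun w => s * (f w - m)).
  by apply: measurable_funM => //; exact: measurable_funB.
(* The centred values are at most 2 B in modulus, which turns 2 (s (f - m))^2 into 8 s^2 B^2. *)
have gB w : `|s * (f w - m)| <= `|s| * (2 * B).
  rewrite normrM ler_wpM2l//; apply: le_trans (ler_normB _ _) _.
  by have := fB w; lra.
have if_ : P.-integrable setT (EFin \o f) by exact: bounded_integrable fB.
have ifm : P.-integrable setT (EFin \o (fun w => f w - m)).
  apply: (@bounded_integrable _ _ _ P _ (B + B)); first exact: measurable_funB.
  by move=> w; apply: le_trans (ler_normB _ _) _; rewrite lerD.
have ig : P.-integrable setT (EFin \o (fun w => s * (f w - m))).
  exact: bounded_integrable gB.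
have ie : P.-integrable setT (EFin \o (fun w => expR (s * (f w - m)))).
  apply: (@bounded_integrable _ _ _ P _ (expR (`|s| * (2 * B)))).
    exact: measurableT_comp.
  move=> w; rewrite ger0_norm ?expR_ge0// ler_expR.
  exact: le_trans (ler_norm _) (gB w).
set E := expR _.
have iE : P.-integrable setT (EFin \o cst E) by exact: finite_measure_integrable_cst.
have iS : P.-integrable setT (EFin \o (fun w => s * (f w - m) + E)).
  by have := integrableD measurableT ig iE; apply: eq_integrable.
apply: (@le_trans _ _ (\int[P]_w (s * (f w - m) + E))).
  apply: le_Rintegral => // w _; apply: le_trans (expR_le_idD_expR_sqr _) _.
  rewrite lerD2l ler_expR -(real_normK (num_real (s * _))).
  have : `|s * (f w - m)| ^+ 2 <= (`|s| * (2 * B)) ^+ 2.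
    by rewrite ler_pXn2r ?nnegrE ?mulr_ge0.
  rewrite exprMn (real_normK (num_real s)); lra.
rewrite RintegralD// RintegralZl// RintegralB//; last exact: finite_measure_integrable_cst.
by rewrite !Rintegral_cst1 fm subrr mulr0 add0r.
Qed.

End dither.

(** * Dithered samples *)

Lemma uniform_on_cube_coord d (T : measurableType d) (R : realType)
    (P : probability T R) (p : nat) (U : {RV P >-> p.-tuple R}) (i : 'I_p) A :
  uniform_on_cube U -> measurable A ->
  P ((fun w => tnth (U w) i) @^-1` A) = uniform_prob (@ltN11 R) A.
Proof.
move=> unifU mA.
pose B (j : 'I_p) := if j == i then A else setT.
have mB j : measurable (B j) by rewrite /B; case: ifP.
have := unifU B mB; rewrite (bigD1 i)//= big1 ?mule1; last first.
  move=> j ji; rewrite /B (negbTE ji); exact: probability_setT.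
rewrite {2}/B eqxx => <-; rewrite /distribution /pushforward; congr (P _).
apply/seteqP; split=> w /=; last by move=> /(_ i); rewrite /B eqxx.
by move=> Aw j; rewrite /B; case: eqP => // ->.
Qed.

(** The index i of ['I_n] stands for dither number i + 1, so X_k and the two dithers of number k
    share the time k. The present of k is what is fresh in the k-th summand, and the past of k
    contains X_0, ..., X_(k-1), on which the k-th level depends. *)
Definition sample_time (n : nat) (s : 'I_n.+1 + ('I_n + 'I_n)) : nat :=
  match s with
  | inl j => j
  | inr (inl i) => i.+1
  | inr (inr i) => i.+1
  end.

Section samples.
Context d (T : measurableType d) (R : realType) (P : probability T R).
Context (p n : nat) (Xs Us Vs : nat -> {RV P >-> p.-tuple R}).
Let F := @sample_family _ _ _ P p n Xs Us Vs.
Hypothesis indF : mutually_independent F.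
Hypothesis unif : forall k, (1 <= k <= n)%N ->
  uniform_on_cube (Us k) /\ uniform_on_cube (Vs k).

Local Notation sub_space J := (g_sigma_algebraType (cylinders F J)).
Local Notation past_space k :=
  (g_sigma_algebraType (cylinders F (past (@sample_time n) k))).
Local Notation present_space k :=
  (g_sigma_algebraType (cylinders F (present (@sample_time n) k))).

Lemma sample_X_measurable (J : pred ('I_n.+1 + ('I_n + 'I_n))) (k : nat) (i : 'I_p)
    (kn : (k < n.+1)%N) : J (inl (Ordinal kn)) ->
  measurable_fun setT (fun w : sub_space J => tnth (Xs k w) i).
Proof.
move=> /(sub_space_coord_measurable (F := F)) mX.
exact: measurableT_comp (@measurable_tnth _ _ _ i) mX.
Qed.

Lemma sample_U_measurable (J : pred ('I_n.+1 + ('I_n + 'I_n))) (k : nat) (i : 'I_p)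
    (kn : (k < n)%N) : J (inr (inl (Ordinal kn))) ->
  measurable_fun setT (fun w : sub_space J => tnth (Us k.+1 w) i).
Proof.
move=> /(sub_space_coord_measurable (F := F)) mX.
exact: measurableT_comp (@measurable_tnth _ _ _ i) mX.
Qed.

Lemma sample_V_measurable (J : pred ('I_n.+1 + ('I_n + 'I_n))) (k : nat) (i : 'I_p)
    (kn : (k < n)%N) : J (inr (inr (Ordinal kn))) ->
  measurable_fun setT (fun w : sub_space J => tnth (Vs k.+1 w) i).
Proof.
move=> /(sub_space_coord_measurable (F := F)) mX.
exact: measurableT_comp (@measurable_tnth _ _ _ i) mX.
Qed.

Lemma coord_measurable (Y : {RV P >-> p.-tuple R}) (i : 'I_p) :
  measurable_fun setT (fun w : T => tnth (Y w) i).
Proof. by apply: measurableT_comp (@measurable_tnth _ _ _ i) _. Qed.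

Lemma dithered_sign_measurable d' (S : measurableType d') (l x u : S -> R) :
  measurable_fun setT l -> measurable_fun setT x -> measurable_fun setT u ->
  measurable_fun setT (fun w => l w * sign1 (x w + l w * u w)).
Proof.
move=> ml mx mu; apply: measurable_funM => //.
apply: measurableT_comp; first exact: measurable_sign1.
by apply: measurable_funD => //; exact: measurable_funM.
Qed.

(** The two dithers are integrated out one after the other, each replacing its dithered sign by a
    truncation; a separate dither in each factor is what allows this. *)
Lemma Rintegral_dithered_prod (k : nat) (i j : 'I_p) (l : R) :
  (1 <= k <= n)%N -> 0 <= l ->
  \int[P]_w (l * sign1 (tnth (Xs k w) i + l * tnth (Us k w) i) *
             (l * sign1 (tnth (Xs k w) j + l * tnth (Vs k w) j))) =
  \int[P]_w (clip l (tnth (Xs k w) i) * clip l (tnth (Xs k w) j)).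
Proof.
case: k => // k kn l0; have {}kn : (k < n)%N by [].
have [uU uV] := unif (k := k.+1) kn.
have kn1 : (k.+1 < n.+1)%N by [].
pose sX : 'I_n.+1 + ('I_n + 'I_n) := inl (Ordinal kn1).
pose sU : 'I_n.+1 + ('I_n + 'I_n) := inr (inl (Ordinal kn)).
pose sV : 'I_n.+1 + ('I_n + 'I_n) := inr (inr (Ordinal kn)).
have nsl x : `|l * sign1 x| <= l by rewrite normrM normr_sign1 mulr1 ger0_norm.
(* The second dither is separated from the sample and the first dither. *)
pose J1 := pred2 sX sU; pose J1' := pred1 sV.
pose f1 (z : sub_space J1 * sub_space J1') :=
  l * sign1 (tnth (Xs k.+1 z.1) i + l * tnth (Us k.+1 z.1) i) *
  (l * sign1 (tnth (Xs k.+1 z.1) j + l * tnth (Vs k.+1 z.2) j)).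
have mf1 : measurable_fun setT f1.
  apply: measurable_funM; apply: dithered_sign_measurable => //.
  - apply: (measurableT_comp (sample_X_measurable (J := J1) i (kn := kn1) _) measurable_fst).
    by rewrite /J1 /= eqxx.
  - apply: (measurableT_comp (sample_U_measurable (J := J1) i (kn := kn) _) measurable_fst).
    by rewrite /J1 /= eqxx ?orbT.
  - apply: (measurableT_comp (sample_X_measurable (J := J1) j (kn := kn1) _) measurable_fst).
    by rewrite /J1 /= eqxx.
  - apply: (measurableT_comp (sample_V_measurable (J := J1') j (kn := kn) _) measurable_snd).
    by rewrite /J1' /= eqxx.
have := sub_space_decouple (P := P) indF (J := J1) (J' := J1') (f := f1) (c := l * l).
move=> /(_ _ mf1 _) ->; first last.
- by move=> z; rewrite normrM ler_pM.
- by move=> s; rewrite /J1 /J1' /=; apply/negP => /andP[/orP[]/eqP -> /eqP].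
(* Now the first dither is separated from the sample, the other factor being a truncation
   already. *)
pose J2 := pred1 sX; pose J2' := pred1 sU.
pose f2 (z : sub_space J2 * sub_space J2') :=
  l * sign1 (tnth (Xs k.+1 z.1) i + l * tnth (Us k.+1 z.2) i) *
  clip l (tnth (Xs k.+1 z.1) j).
have mf2 : measurable_fun setT f2.
  apply: measurable_funM; [apply: dithered_sign_measurable => //|apply: clip_measurable].
  - apply: (measurableT_comp (sample_X_measurable (J := J2) i (kn := kn1) _) measurable_fst).
    by rewrite /J2 /= eqxx.
  - apply: (measurableT_comp (sample_U_measurable (J := J2') i (kn := kn) _) measurable_snd).
    by rewrite /J2' /= eqxx.
  - apply: (measurableT_comp (sample_X_measurable (J := J2) j (kn := kn1) _) measurable_fst).
    by rewrite /J2 /= eqxx.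
have isgn (a : R) (Y : {RV P >-> p.-tuple R}) i' : P.-integrable setT
    (EFin \o (fun w => l * sign1 (a + l * tnth (Y w) i'))).
  apply: (@bounded_integrable _ _ _ P _ l) => //.
  by apply: (@dithered_sign_measurable _ T (cst l) (cst a)) => //; exact: coord_measurable.
transitivity (\int[P]_w f2 (w, w)).
  apply: eq_Rintegral => w _; rewrite /f1 /f2 /= RintegralZl//.
  congr (_ * _); apply: Rintegral_sign1_dither => //.
    exact: coord_measurable.
  by move=> A mA; exact: uniform_on_cube_coord.
have := sub_space_decouple (P := P) indF (J := J2) (J' := J2') (f := f2) (c := l * l).
move=> /(_ _ mf2 _) ->; first last.
- by move=> z; rewrite normrM ler_pM// normr_clip_le.
- by move=> s; rewrite /J2 /J2' /=; apply/negP => /andP[/eqP -> /eqP].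
apply: eq_Rintegral => w _; rewrite /f2 /= RintegralZr//.
congr (_ * _); apply: Rintegral_sign1_dither => //.
  exact: coord_measurable.
by move=> A mA; exact: uniform_on_cube_coord.
Qed.

Definition dithered_prod (i j : 'I_p) (k : nat) (l : R) (w : T) : R :=
  l * sign1 (tnth (Xs k w) i + l * tnth (Us k w) i) *
  (l * sign1 (tnth (Xs k w) j + l * tnth (Vs k w) j)).

Definition clip_bias (t l : R) := 8 * t ^+ 2 * expR (- (l ^+ 2 / (2 * t ^+ 2))).

Lemma normr_dithered_prod i j k l w : `|dithered_prod i j k l w| = l ^+ 2.
Proof.
rewrite /dithered_prod !normrM !normr_sign1 !mulr1 -normrM -expr2 ger0_norm//.
exact: sqr_ge0.
Qed.

Variables (t : R) (i j : 'I_p) (m : R).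
Hypothesis t0 : 0 < t.
Hypothesis psi2X : forall k a, (k <= n)%N ->
  psi2_bound P (fun w => tnth (Xs k w) a) t.
Hypothesis covX : forall k, (k <= n)%N ->
  \int[P]_w (tnth (Xs k w) i * tnth (Xs k w) j) = m.

(** Truncation shifts the mean away from m by at most [clip_bias t l], and the term in |s| pays for
    the shift whatever the sign of s. What remains is the centred dithered product, whose modulus
    before centring is l^2 <= L^2; hence the fourth power. *)
Lemma dithered_mgf k l L s : (1 <= k <= n)%N -> 0 <= l -> l <= L ->
  \int[P]_w expR (s * (dithered_prod i j k l w - m) - `|s| * clip_bias t l) <=
  expR (8 * s ^+ 2 * L ^+ 4).
Proof.
move=> kn l0 lL; have kn' : (k <= n)%N by case/andP: kn.
set b := \int[P]_w (clip l (tnth (Xs k w) i) * clip l (tnth (Xs k w) j)).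
have bm : `|b - m| <= clip_bias t l.
  by rewrite /b -(covX kn'); apply: psi2_bound_clip_prod => //; exact: psi2X.
have mg : measurable_fun setT (dithered_prod i j k l).
  rewrite /dithered_prod; apply: measurable_funM.
    by apply: (@dithered_sign_measurable _ T (cst l)) => //; exact: coord_measurable.
  by apply: (@dithered_sign_measurable _ T (cst l)) => //; exact: coord_measurable.
have gB w : `|dithered_prod i j k l w| <= l ^+ 2 by rewrite normr_dithered_prod.
have me (c1 c2 : R) : P.-integrable setT
    (EFin \o (fun w => expR (s * (dithered_prod i j k l w - c1) - c2))).
  apply: (@bounded_integrable _ _ _ P _ (expR (`|s| * (l ^+ 2 + `|c1|) + `|c2|))).
    apply: measurableT_comp => //; apply: measurable_funB => //.
    by apply: measurable_funM => //; exact: measurable_funB.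
  move=> w; rewrite ger0_norm ?expR_ge0// ler_expR.
  apply: le_trans (ler_norm _) _; apply: le_trans (ler_normB _ _) _.
  rewrite lerD2r normrM ler_wpM2l//; apply: le_trans (ler_normB _ _) _.
  by rewrite lerD2r.
have me' := me b 0.
apply: (@le_trans _ _ (\int[P]_w expR (s * (dithered_prod i j k l w - b) - 0))).
  apply: le_Rintegral => // w _; rewrite ler_expR.
  have : s * (b - m) <= `|s| * clip_bias t l.
    by apply: le_trans (ler_norm _) _; rewrite normrM ler_wpM2l.
  lra.
under eq_Rintegral do rewrite subr0.
apply: le_trans (mgf_le _ mg gB (Rintegral_dithered_prod _ _ kn l0)) _.
rewrite ler_expR; have -> : (l ^+ 2) ^+ 2 = l ^+ 4 by ring.
rewrite ler_wpM2l ?(mulr_ge0 _ (sqr_ge0 s))//.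
by rewrite ler_pXn2r ?nnegrE//; exact: le_trans lL.
Qed.

Variables (lhat : nat -> T -> R) (L : R).
Hypothesis mlhat : forall k, (1 <= k <= n)%N ->
  measurable_fun setT (lhat k : past_space k -> R).
Hypothesis lhat_bnd : forall k w, (1 <= k <= n)%N -> 0 <= lhat k w <= L.

(** Chernoff bound for a level that is random but known from the past: [dithered_mgf] has one bound
    for all frozen levels in [0, L], so the n conditional factors multiply. The sign of s selects
    the tail. *)
Lemma dithered_sum_tail (s a : R) :
  (P [set w | a <= \sum_(1 <= k < n.+1)
       (s * (dithered_prod i j k (lhat k w) w - m) - `|s| * clip_bias t (lhat k w))]%R
   <= (expR (8 * n%:R * s ^+ 2 * L ^+ 4 - a))%:E)%E.
Proof.
(* The level comes from the past copy, the sample and its dithers from the present one. The factor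
   at k = 0 is 1, as X_0 only enters the levels. *)
pose h (k : nat) (z : T * T) : R := if (1 <= k <= n)%N then
  expR (s * (dithered_prod i j k (lhat k z.1) z.2 - m) -
        `|s| * clip_bias t (lhat k z.1)) else 1.
pose c k := if (1 <= k)%N then expR (8 * s ^+ 2 * L ^+ 4) else 1.
have cb_ge0 l : 0 <= clip_bias t l.
  by rewrite mulr_ge0 ?expR_ge0// mulr_ge0 ?sqr_ge0.
have mcb : measurable_fun setT (clip_bias t).
  apply: measurable_funM => //; apply: measurableT_comp => //.
  by apply: measurableT_comp => //; apply: measurable_funM.
have mh k : measurable_fun setT (h k : (past_space k * present_space k)%type -> R).
  rewrite /h /=; case kn: (1 <= k <= n)%N; last exact: measurable_cst.
  have kn' := kn.
  have ml : measurable_fun setT (fun z : (past_space k * present_space k)%type => lhat k z.1).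
    exact: measurableT_comp (mlhat kn) measurable_fst.
  apply: measurableT_comp => //; apply: measurable_funB; last first.
    by apply: measurable_funM => //; exact: measurableT_comp mcb ml.
  apply: measurable_funM => //; apply: measurable_funB => //.
  case: k kn kn' ml => // k kn; rewrite /= => kn' ml.
  have kn1 : (k.+1 < n.+1)%N by [].
  rewrite /dithered_prod; apply: measurable_funM; apply: dithered_sign_measurable => //.
  - apply: (measurableT_comp (sample_X_measurable i (kn := kn1) _) measurable_snd).
    by rewrite /present /= eqxx.
  - apply: (measurableT_comp (sample_U_measurable i (kn := kn') _) measurable_snd).
    by rewrite /present /= eqxx.
  - apply: (measurableT_comp (sample_X_measurable j (kn := kn1) _) measurable_snd).
    by rewrite /present /= eqxx.
  - apply: (measurableT_comp (sample_V_measurable j (kn := kn') _) measurable_snd).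
    by rewrite /present /= eqxx.
have hb k z : 0 <= h k z <= expR (`|s| * (L ^+ 2 + `|m|)).
  rewrite /h; case: ifP => kn; last first.
    by rewrite ler01/= -expR0 ler_expR mulr_ge0// addr_ge0// sqr_ge0.
  rewrite expR_ge0/= ler_expR; have := lhat_bnd z.1 kn => /andP[l0 lL].
  have : s * (dithered_prod i j k (lhat k z.1) z.2 - m) <= `|s| * (L ^+ 2 + `|m|).
    apply: le_trans (ler_norm _) _; rewrite normrM ler_wpM2l//.
    apply: le_trans (ler_normB _ _) _; rewrite lerD2r normr_dithered_prod.
    by rewrite ler_pXn2r ?nnegrE//; exact: le_trans lL.
  by have := mulr_ge0 (normr_ge0 s) (cb_ge0 (lhat k z.1)); lra.
have hc k w : \int[P]_w' h k (w, w') <= c k.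
  rewrite /h /c /=; case kn : (1 <= k <= n)%N; first (have [k1 _] := andP kn).
    by rewrite k1; have /andP[l0 lL] := lhat_bnd w kn; exact: dithered_mgf.
  rewrite Rintegral_cst1; case: ifP => // _.
  by rewrite -expR0 ler_expR (mulr_ge0 (mulr_ge0 _ (sqr_ge0 s)))// exprn_even_ge0.
have := Rintegral_prod_le indF (time := @sample_time n) n.+1 mh hb hc.
have -> : \prod_(0 <= k < n.+1) c k = expR (8 * n%:R * s ^+ 2 * L ^+ 4).
  rewrite big_nat_recl//= mul1r prodr_const_nat subn0 -expRM_natl.
  by congr expR; ring.
have hE w : \prod_(0 <= k < n.+1) h k (w, w) = expR (\sum_(1 <= k < n.+1)
       (s * (dithered_prod i j k (lhat k w) w - m) - `|s| * clip_bias t (lhat k w))).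
  rewrite big_nat_recl//= /h/= mul1r expR_sum big_add1/=.
  rewrite !big_mkord; apply: eq_bigr => k _.
  by rewrite ltn_ord.
under eq_Rintegral do rewrite hE.
move=> hle.
have mdiag k : measurable_fun setT (fun w : T => h k (w, w)).
  suff mp : measurable_fun setT (fun w : T =>
      ((w, w) : (past_space k * present_space k)%type)).
    exact: measurableT_comp (mh k) mp.
  by apply: measurable_fun_pair; exact: sub_space_id_measurable.
have mH : measurable_fun setT (fun w => \prod_(0 <= k < n.+1) h k (w, w)).
  exact: measurable_prod.
have iH : P.-integrable setT (EFin \o (fun w => \prod_(0 <= k < n.+1) h k (w, w))).
  apply: (@bounded_integrable _ _ _ P _ (\prod_(0 <= k < n.+1) expR (`|s| * (L ^+ 2 + `|m|)))) => // w.
  rewrite ger0_norm; first by apply: ler_prod => // k _; exact: hb.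
  by rewrite prodr_ge0// => k _; case/andP: (hb k (w, w)).
rewrite (_ : (fun w => _) = (fun w => expR (\sum_(1 <= k < n.+1)
   (s * (dithered_prod i j k (lhat k w) w - m) - `|s| * clip_bias t (lhat k w))))) in mH iH; last first.
  by apply/funext => w; exact: hE.
have := markov_le mH iH (fun=> expR_ge0 _) (expR_gt0 a) hle.
rewrite expRD expRN; apply: le_trans.
by under eq_set do rewrite -ler_expR.
Qed.

End samples.

Lemma union_bound d (T : measurableType d) (R : realType) (P : probability T R)
    (I : finType) (A : I -> set T) (e : R) : (forall i, measurable (A i)) ->
  (forall i, P (A i) <= e%:E)%E -> (P (\bigcup_i A i) <= (#|I|%:R * e)%:E)%E.
Proof.
move=> mA Ae.
have h (s : seq I) : measurable (\big[setU/set0]_(i <- s) A i) /\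
    (P (\big[setU/set0]_(i <- s) A i) <= ((size s)%:R * e)%:E)%E.
  elim: s => [|i s [mB IH]]; first by rewrite big_nil measure0 mul0r.
  rewrite big_cons; split; first exact: measurableU.
  rewrite /= -addn1 natrD addrC mulrDl mul1r EFinD.
  apply: (@le_trans _ _ (P (A i) + P (\big[setU/set0]_(i <- s) A i))%E).
    exact: measureU2.
  exact: leeD.
have [mU] := h (enum I); rewrite -cardT; apply: le_trans.
rewrite le_measure ?inE//=; first exact: fin_bigcup_measurable.
by move=> w [i _ Aiw]; rewrite big_enum (bigD1 i)//=; left.
Qed.

(** * Tails of the sample maxima and of the sample means *)

Section tails.
Context d (T : measurableType d) (R : realType) (P : probability T R).
Context (p n : nat) (Xs Us Vs : nat -> {RV P >-> p.-tuple R}).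
Let F := @sample_family _ _ _ P p n Xs Us Vs.

Lemma sample_max_tail (t r : R) : 0 < t -> 0 <= r ->
  (forall k a, (k <= n)%N -> psi2_bound P (fun w => tnth (Xs k w) a) t) ->
  (P (\bigcup_(ka : 'I_n.+1 * 'I_p) [set w | r <= `|tnth (Xs ka.1 w) ka.2|]%R) <=
   ((n.+1 * p)%:R * (2 * expR (- (r ^+ 2 / t ^+ 2))))%:E)%E.
Proof.
move=> t0 r0 hX; have -> : (n.+1 * p)%N = #|{: 'I_n.+1 * 'I_p}|.
  by rewrite card_prod !card_ord.
apply: union_bound => -[k a] /=.
  rewrite -[X in measurable X]setTI; apply: measurable_fun_le => //.
  by apply: measurableT_comp => //; exact: coord_measurable.
by apply: psi2_bound_tail => //; apply: hX; rewrite -ltnS.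
Qed.

Hypothesis indF : mutually_independent F.

Local Notation past_space k :=
  (g_sigma_algebraType (cylinders F (past (@sample_time n) k))).
Local Notation present_space k :=
  (g_sigma_algebraType (cylinders F (present (@sample_time n) k))).

(** Chernoff bound with the parameter s of [psi2_bound_laplace]: the k factors give exp (- k c^2 /
    4), and a threshold at a quarter of the guaranteed mean c sigma costs only half of this
    exponent. *)
Lemma sample_sum_lower_tail (K sigma c : R) (i : 'I_p) (k : nat) :
  c = (32 * K ^+ 2)^-1 -> 0 < K -> 0 < sigma -> (k <= n)%N ->
  (forall j, (j <= n)%N -> psi2_bound P (fun w => tnth (Xs j w) i) (2 * K * sigma)) ->
  (forall j, (j <= n)%N ->
     \int[P]_w (tnth (Xs j w) i * tnth (Xs j w) i) = sigma ^+ 2) ->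
  (P [set w | \sum_(0 <= j < k) `|tnth (Xs j w) i| <= k%:R * (c * sigma / 4)]%R <=
   (expR (- (k%:R * c ^+ 2 / 8)))%:E)%E.
Proof.
move=> cE K0 s0 kn hX h2.
have c0 : 0 < c by rewrite cE invr_gt0 mulr_gt0// exprn_gt0.
set s := c / (2 * sigma); have s_gt0 : 0 < s by rewrite divr_gt0// mulr_gt0.
pose h (j : nat) (z : T * T) : R :=
  if (j <= n)%N then expR (- (s * `|tnth (Xs j z.2) i|)) else 0.
have mh j : measurable_fun setT (h j : (past_space j * present_space j)%type -> R).
  rewrite /h; case jn : (j <= n)%N; last exact: measurable_cst.
  have jn1 : (j < n.+1)%N by [].
  apply: measurableT_comp => //; apply: measurableT_comp => //.
  apply: measurable_funM => //; apply: measurableT_comp => //.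
  apply: (measurableT_comp (sample_X_measurable i (kn := jn1) _) measurable_snd).
  by rewrite /present /= eqxx.
have hb j z : 0 <= h j z <= 1.
  rewrite /h; case: ifP => _; last by rewrite lexx ler01.
  by rewrite expR_ge0/= -expR0 ler_expR oppr_le0 mulr_ge0// ltW.
have hc j w : \int[P]_w' h j (w, w') <= expR (- (c ^+ 2 / 4)).
  rewrite /h /=; case jn : (j <= n)%N; last by rewrite Rintegral_cst1 expR_ge0.
  exact: psi2_bound_laplace cE K0 s0 (hX _ jn) (h2 _ jn).
have := Rintegral_prod_le indF (time := @sample_time n) k mh
  (b := fun=> 1) hb (c := fun=> expR (- (c ^+ 2 / 4))) hc.
rewrite prodr_const_nat subn0 -expRM_natl.
have hE w : \prod_(0 <= j < k) h j (w, w) =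
    expR (- (s * \sum_(0 <= j < k) `|tnth (Xs j w) i|)).
  rewrite mulr_sumr -sumrN expR_sum !big_mkord; apply: eq_bigr => j _.
  by rewrite /h/= (leq_trans (ltnW (ltn_ord j)) kn).
under eq_Rintegral do rewrite hE.
move=> hle.
have mH : measurable_fun setT (fun w => expR (- (s * \sum_(0 <= j < k) `|tnth (Xs j w) i|))).
  apply: measurableT_comp => //; apply: measurableT_comp => //.
  apply: measurable_funM => //; apply: measurable_sum => j.
  by apply: measurableT_comp => //; exact: coord_measurable.
have iH : P.-integrable setT (EFin \o (fun w => expR (- (s * \sum_(0 <= j < k) `|tnth (Xs j w) i|)))).
  apply: (@bounded_integrable _ _ _ P _ 1) => // w.
  rewrite ger0_norm ?expR_ge0// -expR0 ler_expR oppr_le0 mulr_ge0 ?(ltW s_gt0)//.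
  exact: sumr_ge0.
have := markov_le mH iH (fun=> expR_ge0 _) (expR_gt0 (- (s * (k%:R * (c * sigma / 4))))) hle.
rewrite -expRN -expRD opprK.
have -> : k%:R * - (c ^+ 2 / 4) + s * (k%:R * (c * sigma / 4)) = - (k%:R * c ^+ 2 / 8).
  by rewrite /s; field; rewrite gt_eqF.
apply: le_trans; rewrite le_eqVlt; apply/orP; left; apply/eqP; congr (P _).
by apply/seteqP; split=> w /=; rewrite ler_expR lerN2 ler_pM2l.
Qed.

End tails.

(** * The covariance matrix, and transfer of moments to the copies of X *)

Section law_transfer.
Context d (T : measurableType d) (R : realType) (P : probability T R) (p : nat).
Implicit Types X Y : {RV P >-> p.-tuple R}.

Lemma same_law_integral X Y (f : p.-tuple R -> R) : same_law Y X ->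
  measurable_fun setT f -> P.-integrable setT (fun w => (f (X w))%:E) ->
  P.-integrable setT (fun w => (f (Y w))%:E) /\
  \int[P]_w f (Y w) = \int[P]_w f (X w).
Proof.
move=> YX mf iX.
have law g : (\int[distribution P Y]_z g z = \int[distribution P X]_z g z)%E.
  by apply: eq_measure_integral => A mA _; exact: YX.
have mfE : measurable_fun setT (fun z => (f z)%:E) by exact/measurable_EFinP.
have mfa : measurable_fun setT (fun z => `|(f z)%:E|%E) by exact: measurableT_comp.
have iY : P.-integrable setT (fun w => (f (Y w))%:E).
  apply/integrableP; split.
    apply/measurable_EFinP; apply: measurableT_comp mf _; exact: measurable_funPT.
  have -> : (\int[P]_w `|(f (Y w))%:E| = \int[distribution P Y]_z `|(f z)%:E|)%E.
    by rewrite ge0_integral_distribution.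
  rewrite law ge0_integral_distribution//.
  by case/integrableP: iX.
split=> //; congr fine.
have -> : (\int[P]_w (f (Y w))%:E = \int[distribution P Y]_z (f z)%:E)%E.
  by rewrite integral_distribution.
by rewrite law integral_distribution.
Qed.

Lemma coord_sqr_integrable X i j : square_integrable X ->
  P.-integrable setT (fun w => (tnth (X w) i * tnth (X w) j)%:E).
Proof.
by move=> hX; have /Lfun1_integrable := Lfun2_mul_Lfun1 (hX i) (hX j); apply: eq_integrable.
Qed.

Lemma covmxE X i j : square_integrable X ->
  covmx X i j = \int[P]_w (tnth (X w) i * tnth (X w) j).
Proof. by move=> hX; rewrite mxE unlock. Qed.

Lemma covmx_diag_ge0 X i : square_integrable X -> 0 <= covmx X i i.
Proof. by move=> hX; rewrite covmxE//; apply: Rintegral_ge0 => w _; rewrite -expr2 sqr_ge0. Qed.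

Lemma normr_covmx_le X (S : R) i j : square_integrable X ->
  (forall a, covmx X a a <= S) -> `|covmx X i j| <= S.
Proof.
move=> hX hS; rewrite covmxE//.
have iij := coord_sqr_integrable i j hX.
have ii := coord_sqr_integrable i i hX; have jj := coord_sqr_integrable j j hX.
apply: le_trans (le_normr_Rintegral _ iij) _ => //.
have iD : P.-integrable setT (EFin \o (fun w => tnth (X w) i * tnth (X w) i + tnth (X w) j * tnth (X w) j)).
  by have := integrableD measurableT ii jj; apply: eq_integrable.
apply: (@le_trans _ _ (\int[P]_w (2^-1 * (tnth (X w) i * tnth (X w) i + tnth (X w) j * tnth (X w) j)))).
  apply: le_Rintegral => //.
  - by have := integrable_abse iij; apply: eq_integrable.
  - by have := integrableZl measurableT 2^-1 iD; apply: eq_integrable.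
  move=> w _; rewrite normrM -!expr2 -(real_normK (num_real (tnth (X w) i))).
  rewrite -(real_normK (num_real (tnth (X w) j))).
  by move: `|tnth (X w) i| `|tnth (X w) j| => u v; have := sqr_ge0 (u - v); nra.
rewrite RintegralZl// RintegralD// -!covmxE//.
by have := hS i; have := hS j; lra.
Qed.

(** An off-diagonal entry is at most the mean of two diagonal ones, so the maximum norm is a
    variance. The coordinate found here is the one whose sample means bound the adaptive level from
    below. *)
Lemma normr_covmx_max X (i0 : 'I_p) : square_integrable X ->
  exists i, `|covmx X| = covmx X i i.
Proof.
move=> hX.
have [i _ imax] := @arg_maxP _ _ _ i0 predT (fun a => covmx X a a) isT.
exists i; apply/eqP; rewrite eq_le; apply/andP; split.
  rewrite /Num.norm/= mx_normrE; apply: bigmax_le => [|ij _].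
    exact: covmx_diag_ge0.
  by apply: normr_covmx_le => // a; exact: imax.
rewrite /Num.norm/= mx_normrE.
apply: le_trans (le_bigmax _ _ (i, i)) => /=.
exact: ler_norm.
Qed.

(** Testing against a basis vector bounds the psi_2 norm by K sqrt S. As the norm is an infimum, the
    factor 2 provides the strict inequality from which an admissible t' < 2 K sqrt S is extracted;
    the exponential moment decreases in t. *)
Lemma subgaussian_psi2_bound X (K S : R) i : square_integrable X ->
  subgaussian K X -> 0 < K -> 0 < S -> covmx X i i <= S ->
  psi2_bound P (fun w => tnth (X w) i) (2 * K * Num.sqrt S).
Proof.
move=> hX subX K0 S0 hS.
have mX : measurable_fun setT (fun w => tnth (X w) i) by exact: coord_measurable.
have innerE w : inner (colv (X w)) (delta_mx i ord0) = tnth (X w) i.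
  rewrite /inner (bigD1 i)//= big1 ?addr0; first by rewrite !mxE !eqxx mulr1.
  by move=> j /negbTE ji; rewrite !mxE ji mulr0.
have := subX (delta_mx i ord0).
under eq_fun do rewrite innerE.
under [in leRHS]eq_fun do rewrite innerE.
have -> : ('E_P[fun w => (tnth (X w) i ^+ 2)%R] = (covmx X i i)%:E)%E.
  rewrite covmxE// unlock -Rintegral_EFin; last exact: coord_sqr_integrable.
  by apply: eq_integral => w _; rewrite expr2.
rewrite poweR_EFin powR12_sqrt ?covmx_diag_ge0// => hle.
set s := 2 * K * Num.sqrt S.
have sS : 0 < Num.sqrt S by rewrite sqrtr_gt0.
have lts : (K%:E * (Num.sqrt (covmx X i i))%:E < s%:E)%E.
  rewrite -EFinM lte_fin; apply: (@le_lt_trans _ _ (K * Num.sqrt S)).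
    by rewrite ler_wpM2l ?(ltW K0)// ler_wsqrtr.
  by rewrite /s; nra.
have /ereal_inf_lt [_ [t' [t'0 ht'] <-]] := le_lt_trans hle lts.
rewrite lte_fin => t's.
have s0 : 0 < s := lt_trans t'0 t's.
have mexp (u : R) : measurable_fun setT (fun w => expR (tnth (X w) i ^+ 2 / u ^+ 2)).
  by apply: measurableT_comp => //; apply: measurable_funM => //; exact: measurable_funX.
have e2 : (\int[P]_w (expR (tnth (X w) i ^+ 2 / s ^+ 2))%:E <= 2%:E)%E.
  move: ht'; rewrite unlock; apply: le_trans; apply: ge0_le_integral => //.
  - by apply/measurable_EFinP; exact: mexp.
  - by apply/measurable_EFinP; exact: mexp.
  - move=> w _; rewrite lee_fin ler_expR ler_wpM2l ?sqr_ge0//.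
    by rewrite lef_pV2 ?posrE ?exprn_gt0// ler_pXn2r ?nnegrE ?ltW.
have ie : P.-integrable setT (fun w => (expR (tnth (X w) i ^+ 2 / s ^+ 2))%:E).
  apply/integrableP; split; first exact/measurable_EFinP.
  under eq_integral do rewrite gee0_abs ?lee_fin ?expR_ge0//.
  exact: le_lt_trans e2 (ltry _).
split=> //.
by rewrite -lee_fin -Rintegral_EFin.
Qed.

Lemma same_law_psi2_bound X Y i t : same_law Y X ->
  psi2_bound P (fun w => tnth (X w) i) t -> psi2_bound P (fun w => tnth (Y w) i) t.
Proof.
move=> YX [mX iX eX].
have mf : measurable_fun setT (fun z : p.-tuple R => expR (tnth z i ^+ 2 / t ^+ 2)).
  apply: measurableT_comp => //; apply: measurable_funM => //.
  by apply: measurable_funX; exact: measurable_tnth.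
have [iY eY] := same_law_integral YX mf iX.
by split=> //; [exact: coord_measurable|rewrite eY].
Qed.

Lemma same_law_covmx X Y i j : same_law Y X -> square_integrable X ->
  \int[P]_w (tnth (Y w) i * tnth (Y w) j) = covmx X i j.
Proof.
move=> YX hX; rewrite covmxE//.
apply: (proj2 (same_law_integral (f := fun z => tnth z i * tnth z j) YX _ _)).
  by apply: measurable_funM; exact: measurable_tnth.
exact: coord_sqr_integrable.
Qed.

(** The square of the coordinate is nonnegative with integral 0. This serves the case of a vanishing
    covariance matrix. *)
Lemma same_law_coord_null X Y i : same_law Y X -> square_integrable X ->
  covmx X i i = 0 -> P [set w | tnth (Y w) i != 0] = 0%E.
Proof.
move=> YX hX c0.
have mf : measurable_fun setT (fun z : p.-tuple R => tnth z i * tnth z i).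
  by apply: measurable_funM; exact: measurable_tnth.
have [iY eY] := same_law_integral YX mf (coord_sqr_integrable i i hX).
have mY := coord_measurable Y i.
have /(ae_eq_integral_abs P measurableT) : measurable_fun setT (fun w => (tnth (Y w) i * tnth (Y w) i)%:E).
  exact: measurable_int iY.
move=> [+ _] => /(_ _)[].
  transitivity (\int[P]_w (tnth (Y w) i * tnth (Y w) i)%:E)%E.
    by apply: eq_integral => w _; rewrite gee0_abs// lee_fin -expr2 sqr_ge0.
  by rewrite Rintegral_EFin// eY -covmxE// c0.
move=> N [mN PN sN].
have mA : measurable [set w | tnth (Y w) i != 0].
  rewrite [X in measurable X](_ : _ = ~` ((fun w => tnth (Y w) i) @^-1` [set 0])).
    by apply: measurableC; rewrite -[X in measurable X]setTI; exact: mY.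
  by apply/seteqP; split=> w /= /eqP.
apply/eqP; rewrite -measure_le0 -PN le_measure ?inE//.
move=> w /= Yw; apply: sN => /= /(_ I) /= [] /eqP.
by rewrite mulf_eq0 orbb (negbTE Yw).
Qed.

End law_transfer.

(** * The estimator *)

Lemma mx_norm_le (R : realType) (m n : nat) (A : 'M[R]_(m, n)) (r : R) :
  0 <= r -> (forall i j, `|A i j| <= r) -> `|A| <= r.
Proof.
by move=> r0 Ar; rewrite /Num.norm/= mx_normrE; apply: bigmax_le => // -[i j] _; exact: Ar.
Qed.

Lemma entry_le_mx_norm (R : realType) (m n : nat) (A : 'M[R]_(m, n)) i j :
  `|A i j| <= `|A|.
Proof. by rewrite [leRHS]/Num.norm/= mx_normrE; exact: (le_bigmax _ _ (i, j)). Qed.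

Lemma mx_norm_measurable d (S : measurableType d) (R : realType) (m n : nat)
    (A : S -> 'M[R]_(m, n)) :
  (forall i j, measurable_fun setT (fun w => A w i j)) ->
  measurable_fun setT (fun w => `|A w|).
Proof.
move=> mA; rewrite (_ : (fun w => _) =
    (fun w => \big[Num.max/0]_(ij <- index_enum ('I_m * 'I_n)%type) `|A w ij.1 ij.2|)).
  elim: (index_enum _) => [|[i j] s IH].
    by under eq_fun do rewrite big_nil; exact: measurable_cst.
  under eq_fun do rewrite big_cons /=.
  by apply: measurable_maxr => //; exact: measurableT_comp.
by apply/funext => w; rewrite /Num.norm/= mx_normrE.
Qed.

Lemma frobenius_measurable d (S : measurableType d) (R : realType) (m n : nat)
    (A : S -> 'M[R]_(m, n)) :
  (forall i j, measurable_fun setT (fun w => A w i j)) ->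
  measurable_fun setT (fun w => frobenius (A w)).
Proof.
move=> mA; rewrite /frobenius.
have mS : measurable_fun setT (fun w => \sum_i \sum_j `|A w i j| ^+ 2).
  apply: measurable_sum => i; apply: measurable_sum => j.
  by apply: measurable_funX; exact: measurableT_comp.
rewrite (_ : (fun w => _) = (fun w => (\sum_i \sum_j `|A w i j| ^+ 2) `^ 2^-1)).
  exact: (measurableT_comp (f := fun x => x `^ 2^-1) (measurable_powR _) mS).
apply/funext => w; rewrite powR12_sqrt//.
by apply: sumr_ge0 => i _; apply: sumr_ge0 => j _; rewrite sqr_ge0.
Qed.

(** One entrywise bound on the unmasked error yields both norm bounds, so a single event serves for
    both. *)
Lemma hadamard_sub_norm_le (R : realType) (n : nat) (M A B : 'M[R]_n) (D : R) :
  0 <= D -> (forall i j, `|A i j - B i j| <= D) ->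
  `|hadamard M A - hadamard M B| <= `|M| * D.
Proof.
move=> D0 AB; apply: mx_norm_le => [|i j]; first by rewrite mulr_ge0.
rewrite !mxE -mulrBr normrM ler_pM//; exact: entry_le_mx_norm.
Qed.

Lemma hadamard_sub_frobenius_le (R : realType) (n : nat) (M A B : 'M[R]_n) (D : R) :
  0 <= D -> (forall i j, `|A i j - B i j| <= D) ->
  frobenius (hadamard M A - hadamard M B) <= frobenius M * D.
Proof.
move=> D0 AB; rewrite /frobenius -[X in _ * X](@ger0_norm _ D)// -sqrtr_sqr -sqrtrM; last first.
  by apply: sumr_ge0 => i _; apply: sumr_ge0 => j _; rewrite sqr_ge0.
apply: ler_wsqrtr; rewrite mulr_suml; apply: ler_sum => i _.
rewrite mulr_suml; apply: ler_sum => j _.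
rewrite !mxE -mulrBr normrM exprMn ler_wpM2l ?sqr_ge0//.
by rewrite ler_pXn2r ?nnegrE.
Qed.

Lemma adap_asymE (R : realType) (p n : nat) (l : nat -> R)
    (x tau tau' : nat -> 'cV[R]_p) i j :
  adap_asym n l x tau tau' i j = n%:R^-1 * \sum_(1 <= k < n.+1)
    (l k * sign1 (x k i ord0 + tau k i ord0) *
     (l k * sign1 (x k j ord0 + tau' k j ord0))).
Proof.
rewrite /adap_asym summxE mulr_sumr; apply: eq_bigr => k _.
by rewrite !mxE big_ord1 !mxE; ring.
Qed.

Lemma sum_inv_sqr_le2 (R : realType) (n : nat) :
  \sum_(1 <= k < n.+1) (k%:R ^+ 2)^-1 <= 2 :> R.
Proof.
case: n => [|n]; first by rewrite big_geq.
(* Strengthened for the induction: 1 / (x + 1)^2 falls short of 1 / x - 1 / (x + 1) by 1 / (x (x +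
   1)^2). *)
suff : \sum_(1 <= k < n.+2) (k%:R ^+ 2)^-1 <= 2 - n.+1%:R^-1 :> R.
  by move/le_trans; apply; rewrite gerBl invr_ge0.
elim: n => [|n IH].
  by rewrite big_nat1 expr1n invr1; lra.
rewrite big_nat_recr//=; apply: le_trans (lerD IH (lexx _)) _.
rewrite -[n.+2]addn1 natrD; have : 1 <= n.+1%:R :> R by rewrite ler1n.
move: (n.+1%:R : R) => x x1; rewrite -subr_ge0.
have -> : 2 - (x + 1)^-1 - (2 - x^-1 + ((x + 1) ^+ 2)^-1) =
    (x * (x + 1) ^+ 2)^-1.
  by field; apply/andP; split; lra.
by rewrite invr_ge0 mulr_ge0 ?sqr_ge0//; lra.
Qed.

Lemma clip_bias_le (R : realType) (K S theta C1 A l avg : R) (k : nat) :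
  0 < K -> 0 < S -> 0 < theta -> (0 < k)%N ->
  C1 = 256 * K ^+ 2 * (32 * K ^+ 2) ^+ 2 -> 0 <= avg ->
  l ^+ 2 = C1 * ln k%:R * avg ^+ 2 ->
  (A * theta <= k%:R -> (32 * K ^+ 2)^-1 * Num.sqrt S / 4 <= avg) -> 0 < A ->
  clip_bias (2 * K * Num.sqrt S) l <=
  32 * K ^+ 2 * S * (1 + A ^+ 2 * theta ^+ 2) * (k%:R ^+ 2)^-1.
Proof.
move=> K0 S0 th0 k0 C1E avg0 lE havg A0.
have S2 : Num.sqrt S ^+ 2 = S by rewrite sqr_sqrtr// ltW.
have s0 : 0 < Num.sqrt S by rewrite sqrtr_gt0.
have kR : 1 <= k%:R :> R by rewrite ler1n.
rewrite /clip_bias.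
have -> : (2 * K * Num.sqrt S) ^+ 2 = 4 * K ^+ 2 * S by rewrite -{2}S2; ring.
have -> : 8 * (4 * K ^+ 2 * S) = 32 * K ^+ 2 * S by ring.
have KS0 : 0 <= 32 * K ^+ 2 * S.
  by rewrite mulr_ge0 ?(ltW S0)// mulr_ge0 ?sqr_ge0.
rewrite -[leRHS]mulrA ler_wpM2l//.
have Ath0 : 0 <= A ^+ 2 * theta ^+ 2 by rewrite -exprMn sqr_ge0.
have [kA|kA] := leP (A * theta) k%:R.
  apply: (@le_trans _ _ (k%:R ^+ 2)^-1); last by rewrite ler_peMl ?invr_ge0 ?sqr_ge0// lerDl.
  have -> : (k%:R ^+ 2)^-1 = expR (- (2 * ln k%:R)) :> R.
    by rewrite expRN expRM_natl lnK// posrE; lra.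
  rewrite ler_expR lerN2 ler_pdivlMr; last by rewrite !mulr_gt0// exprn_gt0.
  rewrite lE.
  have lnk : 0 <= ln k%:R :> R by rewrite ln_ge0.
  have c0 : 0 < (32 * K ^+ 2)^-1 by rewrite invr_gt0 mulr_gt0 ?exprn_gt0.
  have hav : ((32 * K ^+ 2)^-1 * Num.sqrt S / 4) ^+ 2 <= avg ^+ 2.
    rewrite ler_pXn2r ?nnegrE ?havg//.
    by rewrite divr_ge0// mulr_ge0 ?(ltW c0) ?(ltW s0).
  have C10 : 0 <= C1.
    by rewrite C1E; apply: mulr_ge0; [apply: mulr_ge0 => //; exact: sqr_ge0|exact: sqr_ge0].
  have : C1 * ln k%:R * ((32 * K ^+ 2)^-1 * Num.sqrt S / 4) ^+ 2 <= C1 * ln k%:R * avg ^+ 2.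
    by rewrite ler_wpM2l// mulr_ge0.
  (* The identity that dictates [C1]: with c = (32 K^2)^-1 one has C1 c^2 / 16 = 16 K^2, and 2 t^2 =
     8 K^2 S, so that l^2 / (2 t^2) >= 2 ln k. *)
  have -> : C1 * ln k%:R * ((32 * K ^+ 2)^-1 * Num.sqrt S / 4) ^+ 2 =
      2 * ln k%:R * (2 * (4 * K ^+ 2 * S)).
    rewrite C1E (_ : (_ * Num.sqrt S / 4) ^+ 2 = ((32 * K ^+ 2)^-1) ^+ 2 * S / 16).
      by field; rewrite gt_eqF.
    by rewrite -{2}S2; field; rewrite gt_eqF.
  by [].
apply: (@le_trans _ _ 1).
  rewrite -expR0 ler_expR oppr_le0 divr_ge0 ?sqr_ge0// !mulr_ge0 ?(ltW K0) ?(ltW S0)//.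
rewrite ler_pdivlMr ?mul1r; last by rewrite exprn_gt0//; lra.
have : k%:R ^+ 2 <= (A * theta) ^+ 2.
  rewrite ler_pXn2r ?nnegrE//; [exact: ltW|by rewrite mulr_ge0// ltW].
by rewrite exprMn; lra.
Qed.

Lemma adap_lambda_ge0 (R : realType) (p : nat) (x : nat -> 'cV[R]_p) k :
  0 <= adap_lambda x k.
Proof. by rewrite mulr_ge0 ?invr_ge0//; exact: sumr_ge0. Qed.

Lemma adap_lambda_measurable d (S : measurableType d) (R : realType) (p : nat)
    (x : nat -> S -> p.-tuple R) (k : nat) :
  (forall j, (j < k)%N -> measurable_fun setT (x j)) ->
  measurable_fun setT (fun w => adap_lambda (fun j => colv (x j w)) k).
Proof.
move=> mx; apply: measurable_funM => //.
under eq_fun do rewrite big_mkord.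
apply: measurable_sum => j; apply: mx_norm_measurable => a b.
under eq_fun do rewrite mxE.
exact: measurableT_comp (@measurable_tnth _ _ _ a) (mx _ (ltn_ord j)).
Qed.

(** * The three exceptional events and the error outside of them *)

Section main.
Context d (T : measurableType d) (R : realType) (P : probability T R).
Context (p n : nat) (Xs Us Vs : nat -> {RV P >-> p.-tuple R}).
Hypothesis indF : mutually_independent (@sample_family _ _ _ P p n Xs Us Vs).
Hypothesis unif : forall k, (1 <= k <= n)%N ->
  uniform_on_cube (Us k) /\ uniform_on_cube (Vs k).
Hypotheses (p2 : (2 <= p)%N) (n2 : (2 <= n)%N).
Variables (K S theta : R) (Sig : 'I_p -> 'I_p -> R) (i0 : 'I_p).
Hypotheses (K0 : 0 < K) (S0 : 0 < S).
Hypothesis psi2X : forall k a, (k <= n)%N ->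
  psi2_bound P (fun w => tnth (Xs k w) a) (2 * K * Num.sqrt S).
Hypothesis covX : forall k i j, (k <= n)%N ->
  \int[P]_w (tnth (Xs k w) i * tnth (Xs k w) j) = Sig i j.
Hypothesis Si0 : Sig i0 i0 = S.
Hypotheses (p_le : p%:R <= expR theta) (n_le : n%:R <= expR theta).
Hypothesis th0 : 0 < theta.
Let C1 := 256 * K ^+ 2 * (32 * K ^+ 2) ^+ 2.
(** A = 24 / c^2, so that the exponent k c^2 / 8 of [sample_sum_lower_tail] is at least 3 theta once
    k >= A theta. *)
Let A := 24 * (32 * K ^+ 2) ^+ 2.
Let avg (k : nat) (w : T) := adap_lambda (fun j => colv (Xs j w)) k.
Variable lamt : nat -> T -> R.
Hypothesis lamtE : forall k w, (1 <= k <= n)%N ->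
  lamt k w = Num.sqrt (C1 * ln k%:R) * avg k w.

(** This is C1 ln n r^2, a bound on the squared levels when all samples are at most r in maximum
    norm. *)
Let B := C1 * ln n%:R * (24 * K ^+ 2 * S * theta).
(* The truncation makes the increments bounded and is inactive outside of
   [large_sample_event]. *)
Let lhat k w := Num.min (lamt k w) (Num.sqrt B).
(** r^2 = 6 theta t^2 with t = 2 K sqrt S, whence the exponent 6 theta in the tail of the sample
    maxima. *)
Let r := Num.sqrt (24 * K ^+ 2 * S * theta).
Let c := (32 * K ^+ 2)^-1.

Definition large_sample_event : set T :=
  \bigcup_(ka : 'I_n.+1 * 'I_p) [set w | r <= `|tnth (Xs ka.1 w) ka.2|].

(** The condition on k sits inside the set, so that the union runs over a finite type and the early
    indices contribute the empty set. *)
Definition small_mean_event : set T :=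
  \bigcup_(k : 'I_n.+1) [set w | A * theta <= k%:R /\
    \sum_(0 <= j < k) `|tnth (Xs j w) i0| <= k%:R * (c * Num.sqrt S / 4)].

(** Chosen so that 8 n s0^2 B^2 = 8 theta: against the threshold 16 theta the Chernoff exponent is
    then - 8 theta. *)
Let s0 := Num.sqrt theta / Num.sqrt n%:R / B.

Definition deviation_event : set T :=
  \bigcup_(ijb : ('I_p * 'I_p) * bool) [set w | 16 * theta <=
    \sum_(1 <= k < n.+1)
      ((-1) ^+ ijb.2 * s0 * (dithered_prod Xs Us Vs ijb.1.1 ijb.1.2 k (lhat k w) w - Sig ijb.1.1 ijb.1.2)
       - `|(-1) ^+ ijb.2 * s0| * clip_bias (2 * K * Num.sqrt S) (lhat k w))].

Let C10 : 0 < C1.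
Proof.
have K2 : 0 < K ^+ 2 by rewrite exprn_gt0.
exact: mulr_gt0 (mulr_gt0 (ltr0n _ 256) K2)
  (exprn_gt0 2 (mulr_gt0 (ltr0n _ 32) K2)).
Qed.

Let lnn0 : 0 < ln n%:R :> R.
Proof. by rewrite ln_gt0// ltr1n. Qed.

Let KSth0 : 0 < 24 * K ^+ 2 * S * theta.
Proof. by rewrite !mulr_gt0 ?exprn_gt0. Qed.

Let B0 : 0 < B.
Proof. exact: mulr_gt0 (mulr_gt0 C10 lnn0) KSth0. Qed.

Let lamt_ge0 k w : (1 <= k <= n)%N -> 0 <= lamt k w.
Proof. by move=> kn; rewrite lamtE// mulr_ge0 ?adap_lambda_ge0. Qed.

Let lnk_ge0 k : (1 <= k <= n)%N -> 0 <= C1 * ln k%:R.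
Proof. by move=> /andP[k1 _]; rewrite mulr_ge0 ?(ltW C10)// ln_ge0// ler1n. Qed.

Let t0 : 0 < 2 * K * Num.sqrt S.
Proof. by rewrite !mulr_gt0 ?sqrtr_gt0. Qed.

Lemma large_sample_event_measurable : measurable large_sample_event.
Proof.
apply: fin_bigcup_measurable => //= -[k a] _ /=.
rewrite -[X in measurable X]setTI; apply: measurable_fun_le => //.
by apply: measurableT_comp => //; exact: coord_measurable.
Qed.

Let small_measurable (k : 'I_n.+1) : measurable [set w | A * theta <= k%:R /\
    \sum_(0 <= j < k) `|tnth (Xs j w) i0| <= k%:R * (c * Num.sqrt S / 4)].
Proof.
have [kA|kA] := boolP (A * theta <= k%:R); last first.
  by rewrite (_ : [set w | _] = set0)//; apply/seteqP; split=> w // [].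
rewrite (_ : [set w | _] = [set w | \sum_(0 <= j < k) `|tnth (Xs j w) i0| <= k%:R * (c * Num.sqrt S / 4)]); last first.
  by apply/seteqP; split=> w // [].
rewrite -[X in measurable X]setTI; apply: measurable_fun_le => //.
by apply: measurable_sum => j; apply: measurableT_comp => //; exact: coord_measurable.
Qed.

Lemma small_mean_event_measurable : measurable small_mean_event.
Proof. by apply: fin_bigcup_measurable. Qed.

(** In both uses [f] is the identity, its source carrying either the full sigma-algebra or that of
    the past. *)
Let lamt_measurable d' (T' : measurableType d') (f : T' -> T) k :
  (1 <= k <= n)%N -> (forall j, (j < k)%N -> measurable_fun setT (Xs j \o f)) ->
  measurable_fun setT (lamt k \o f).
Proof.
move=> kn mX; rewrite (_ : _ \o f = (fun w => Num.sqrt (C1 * ln k%:R) * adap_lambda (fun j => colv ((Xs j \o f) w)) k)).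
  by apply: measurable_funM => //; apply: adap_lambda_measurable.
by apply/funext => w /=; rewrite lamtE.
Qed.

Let mlhat k : (1 <= k <= n)%N -> measurable_fun setT (lhat k :
  g_sigma_algebraType (cylinders (sample_family Xs Us Vs) (past (@sample_time n) k)) -> R).
Proof.
move=> kn; apply: measurable_minr => //.
apply: (lamt_measurable (T' := g_sigma_algebraType (cylinders (sample_family Xs Us Vs) (past (@sample_time n) k))) (f := id)) => // j jk.
have jn : (j < n.+1)%N by rewrite ltnS (leq_trans (ltnW jk))//; case/andP: kn.
by apply: (sub_space_coord_measurable (F := sample_family Xs Us Vs) (i := inl (Ordinal jn))).
Qed.

Let mlhatT k : (1 <= k <= n)%N -> measurable_fun setT (lhat k : T -> R).
Proof.
move=> kn; apply: measurable_minr => //.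
by apply: (lamt_measurable (f := id)).
Qed.

Let lhat_bnd k w : (1 <= k <= n)%N -> 0 <= lhat k w <= Num.sqrt B.
Proof.
by move=> kn; rewrite /lhat le_min lamt_ge0//= sqrtr_ge0/= ge_min lexx orbT.
Qed.

Let deviation_measurable (ijb : ('I_p * 'I_p) * bool) : measurable [set w | 16 * theta <=
    \sum_(1 <= k < n.+1)
      ((-1) ^+ ijb.2 * s0 * (dithered_prod Xs Us Vs ijb.1.1 ijb.1.2 k (lhat k w) w - Sig ijb.1.1 ijb.1.2)
       - `|(-1) ^+ ijb.2 * s0| * clip_bias (2 * K * Num.sqrt S) (lhat k w))].
Proof.
rewrite -[X in measurable X]setTI.
apply: (measurable_fun_le measurableT (measurable_cst (16 * theta))).
under eq_fun do rewrite big_add1 big_mkord.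
apply: measurable_sum => k.
have kn : (1 <= k.+1 <= n)%N by rewrite ltn_ord.
have ml := mlhatT kn.
apply: measurable_funB; apply: measurable_funM => //.
  apply: measurable_funB => //; apply: measurable_funM;
    by apply: dithered_sign_measurable => //; exact: coord_measurable.
apply: measurable_funM => //; apply: measurableT_comp => //.
by apply: measurableT_comp => //; apply: measurable_funM => //; exact: measurable_funX.
Qed.

Lemma deviation_event_measurable : measurable deviation_event.
Proof. by apply: fin_bigcup_measurable. Qed.

Lemma large_sample_event_prob :
  (P large_sample_event <= ((n.+1 * p)%:R * (2 * expR (- (6 * theta))))%:E)%E.
Proof.
apply: le_trans (sample_max_tail t0 (sqrtr_ge0 _) psi2X) _.
rewrite lee_fin ler_wpM2l// ler_wpM2l// ler_expR lerN2.
rewrite sqr_sqrtr ?(ltW KSth0)// exprMn sqr_sqrtr ?(ltW S0)// le_eqVlt.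
by apply/orP; left; apply/eqP; field; rewrite !gt_eqF.
Qed.

Lemma small_mean_event_prob :
  (P small_mean_event <= (n.+1%:R * expR (- (3 * theta)))%:E)%E.
Proof.
rewrite -[in leRHS](card_ord n.+1); apply: union_bound => // k.
have [kA|kA] := boolP (A * theta <= k%:R); last first.
  rewrite (_ : [set w | _] = set0) ?measure0 ?lee_fin ?expR_ge0//.
  by apply/seteqP; split=> w // [].
have kn : (k <= n)%N by rewrite -ltnS.
have := sample_sum_lower_tail indF (erefl c) K0 (_ : 0 < Num.sqrt S) kn
  (fun j => @psi2X j i0) (_ : forall j, (j <= n)%N -> _).
rewrite sqrtr_gt0 => /(_ S0); rewrite sqr_sqrtr ?(ltW S0)//.
move=> /(_ (fun j jn => etrans (@covX j i0 i0 jn) Si0)) h.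
apply: le_trans (le_trans _ h) _.
  rewrite le_measure ?inE//; [by have := small_measurable k; rewrite kA| |by move=> w []].
  rewrite -[X in measurable X]setTI; apply: measurable_fun_le => //.
  by apply: measurable_sum => j; apply: measurableT_comp => //; exact: coord_measurable.
rewrite lee_fin ler_expR lerN2.
have : A * theta * c ^+ 2 / 8 = 3 * theta.
  by rewrite /A /c; field; rewrite gt_eqF.
have : A * theta * (c ^+ 2 / 8) <= k%:R * (c ^+ 2 / 8).
  by rewrite ler_wpM2r// divr_ge0// sqr_ge0.
lra.
Qed.

Lemma deviation_event_prob :
  (P deviation_event <= ((p * p * 2)%:R * expR (- (8 * theta)))%:E)%E.
Proof.
have -> : (p * p * 2)%N = #|{: ('I_p * 'I_p) * bool}|.
  by rewrite !card_prod !card_ord card_bool.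
apply: union_bound => // -[[i j] b] /=.
have := dithered_sum_tail indF unif t0 psi2X (fun k kn => @covX k i j kn) mlhat lhat_bnd
  ((-1) ^+ b * s0) (16 * theta).
move/le_trans; apply; rewrite lee_fin ler_expR exprMn sqrr_sign mul1r.
have -> : Num.sqrt B ^+ 4 = B ^+ 2 by rewrite (exprM _ 2 2) sqr_sqrtr// ltW.
have -> : s0 ^+ 2 = theta / n%:R / B ^+ 2.
  by rewrite /s0 expr_div_n expr_div_n !sqr_sqrtr ?(ltW th0).
have B_neq0 : B != 0 by rewrite gt_eqF.
move: B B_neq0 => B' B'0; rewrite le_eqVlt; apply/orP; left; apply/eqP; field.
by rewrite B'0 pnatr_eq0 -lt0n (ltn_trans _ n2).
Qed.

(** Here [lhat] coincides with [lamt] and the bias bound holds for every k, so the two signs in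
    [deviation_event] bound the centred sum by 16 theta / s0 = 16 sqrt (theta n) B plus the total
    bias. After division by n the former is the first term, with 384 = 16 * 24, and the latter the
    second, with 64 = 32 * 2. *)
Lemma outside_events w i j : ~ large_sample_event w -> ~ small_mean_event w ->
  ~ deviation_event w ->
  `|n%:R^-1 * \sum_(1 <= k < n.+1) dithered_prod Xs Us Vs i j k (lamt k w) w - Sig i j| <=
  S * (384 * K ^+ 2 * C1 * ln n%:R * (theta * Num.sqrt theta / Num.sqrt n%:R) +
       64 * K ^+ 2 * (1 + A ^+ 2 * theta ^+ 2) / n%:R).
Proof.
move=> notL notM notD.
have Xr k a : (k <= n)%N -> `|tnth (Xs k w) a| <= r.
  rewrite -ltnS => kn; rewrite leNgt; apply/negP => rX; apply: notL.
  by exists (Ordinal kn, a) => //=; exact: ltW.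
have r0 : 0 <= r by exact: sqrtr_ge0.
have nR : 0 < n%:R :> R by rewrite ltr0n (ltn_trans _ n2).
have avg_le k : (1 <= k <= n)%N -> avg k w <= r.
  move=> /andP[k1 kn]; rewrite /avg /adap_lambda ler_pdivrMl ?ltr0n// mulrC.
  apply: (@le_trans _ _ (\sum_(0 <= j < k) r)).
    rewrite !big_mkord; apply: ler_sum => l _; apply: mx_norm_le => // a b.
    by rewrite mxE Xr// (leq_trans (ltnW (ltn_ord l))).
  by rewrite sumr_const_nat subn0 mulr_natr.
have lamt_le k : (1 <= k <= n)%N -> lhat k w = lamt k w.
  move=> kn; apply: min_l; rewrite lamtE//.
  rewrite [in leRHS]/B [leRHS]sqrtrM; last by rewrite mulr_ge0 ?(ltW C10) ?(ltW lnn0).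
  rewrite ler_pM ?sqrtr_ge0 ?adap_lambda_ge0 ?avg_le//.
  have [k1 k2] := andP kn.
  by rewrite ler_wsqrtr// ler_wpM2l ?(ltW C10)// ler_ln ?posrE ?ltr0n ?ler_nat// (ltn_trans _ n2).
set bnd := 32 * K ^+ 2 * S * (1 + A ^+ 2 * theta ^+ 2).
have A0 : 0 < A by rewrite /A mulr_gt0// exprn_gt0// mulr_gt0// exprn_gt0.
have bias k : (1 <= k <= n)%N ->
    clip_bias (2 * K * Num.sqrt S) (lamt k w) <= bnd * (k%:R ^+ 2)^-1.
  move=> kn; have [k1 k2] := andP kn.
  apply: (clip_bias_le (avg := avg k w) K0 S0 th0 k1 (erefl C1)) => //.
  - exact: adap_lambda_ge0.
  - by rewrite lamtE// exprMn sqr_sqrtr// lnk_ge0.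
  (* The mean of the maximum norms dominates the mean of the moduli of coordinate [i0], so if the
     former were too small the latter would be as well. *)
  move=> kA; rewrite leNgt; apply/negP => hlt; apply: notM.
  have kn1 : (k < n.+1)%N by [].
  exists (Ordinal kn1) => //=; split=> //.
  apply: (@le_trans _ _ (k%:R * avg k w)).
    rewrite /avg /adap_lambda mulrA mulfV ?mul1r ?pnatr_eq0 -?lt0n//.
    by apply: ler_sum => l _; have := entry_le_mx_norm (colv (Xs l w)) i0 ord0; rewrite mxE.
  by rewrite ler_wpM2l// ltW.
set G := \sum_(1 <= k < n.+1) (dithered_prod Xs Us Vs i j k (lamt k w) w - Sig i j).
set Bt := \sum_(1 <= k < n.+1) clip_bias (2 * K * Num.sqrt S) (lamt k w).
have Bt_le : Bt <= bnd * 2.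
  apply: (@le_trans _ _ (bnd * \sum_(1 <= k < n.+1) (k%:R ^+ 2)^-1)).
    rewrite mulr_sumr /Bt !big_add1 !big_mkord; apply: ler_sum => k _.
    by apply: bias; rewrite ltn_ord.
  rewrite ler_wpM2l ?sum_inv_sqr_le2//.
  by rewrite /bnd mulr_ge0// ?mulr_ge0 ?(ltW S0) ?(ltW K0)// addr_ge0// -exprMn sqr_ge0.
have s0_gt0 : 0 < s0 by rewrite /s0 !divr_gt0 ?sqrtr_gt0.
have dev (b : bool) : s0 * ((-1) ^+ b * G - Bt) < 16 * theta.
  rewrite ltNge; apply/negP => h; apply: notD; exists ((i, j), b) => //=.
  move: h; congr (_ <= _); rewrite /G /Bt mulrBr !mulr_sumr -sumrB.
  rewrite !big_add1 !big_mkord; apply: eq_bigr => k _.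
  have kn : (1 <= k.+1 <= n)%N by rewrite ltn_ord.
  rewrite lamt_le// normrM normr_sign mul1r (ger0_norm (ltW s0_gt0)).
  by rewrite mulrA [s0 * _]mulrC.
have thE : 16 * theta = s0 * (16 * (Num.sqrt theta * Num.sqrt n%:R * B)).
  have {1}-> : theta = Num.sqrt theta ^+ 2 by rewrite sqr_sqrtr// ltW.
  rewrite /s0; have := B0; move: B => B' B'0; field.
  by rewrite !gt_eqF// sqrtr_gt0.
set a := 16 * (Num.sqrt theta * Num.sqrt n%:R * B) in thE.
have G1 : G <= a + Bt.
  by have := dev false; rewrite expr0 mul1r thE ltr_pM2l//; lra.
have G2 : - G <= a + Bt.
  by have := dev true; rewrite expr1 mulN1r thE ltr_pM2l//; lra.
have Gle : `|G| <= a + bnd * 2.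
  by rewrite ler_norml; apply/andP; split; lra.
have -> : n%:R^-1 * \sum_(1 <= k < n.+1) dithered_prod Xs Us Vs i j k (lamt k w) w - Sig i j = n%:R^-1 * G.
  rewrite /G sumrB mulrBr sumr_const_nat subn1/= -[Sig i j *+ n]mulr_natl.
  by rewrite mulrA mulVf ?mul1r// gt_eqF.
rewrite normrM ger0_norm ?invr_ge0 ?(ltW nR)//.
apply: (@le_trans _ _ (n%:R^-1 * (a + bnd * 2))).
  by rewrite ler_wpM2l// invr_ge0 ltW.
rewrite le_eqVlt; apply/orP; left; apply/eqP; rewrite /a /bnd /B.
have e : n%:R^-1 * Num.sqrt n%:R = (Num.sqrt n%:R)^-1 :> R.
  have sn0 : Num.sqrt n%:R != 0 :> R by rewrite gt_eqF// sqrtr_gt0.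
  by rewrite -{1}(sqr_sqrtr (ltW nR)) expr2 invfM mulfVK.
have -> : forall (x y : R), n%:R^-1 * (16 * (x * Num.sqrt n%:R * y) + 
    32 * K ^+ 2 * S * (1 + A ^+ 2 * theta ^+ 2) * 2) =
    n%:R^-1 * Num.sqrt n%:R * (16 * x * y) +
    64 * K ^+ 2 * S * (1 + A ^+ 2 * theta ^+ 2) / n%:R by move=> x y; ring.
by rewrite e; ring.
Qed.

(** The exponents 6, 3 and 8 outweigh the numbers (n + 1) p, n + 1 and 2 p^2 of events: for q = exp
    (- theta), the bounds p q <= 1 and n q <= 1 leave 4 q^4 + 2 q^2 + 2 q^6, which is at most 2 q
    because p >= 2 forces q <= 1/2. *)
Lemma bad_event_prob :
  (P (large_sample_event `|` small_mean_event `|` deviation_event) <=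
   (2 * expR (- theta))%:E)%E.
Proof.
have mL := large_sample_event_measurable.
have mM := small_mean_event_measurable.
have mD := deviation_event_measurable.
apply: (le_trans (measureU2 _ (measurableU _ _ mL mM) mD)).
apply: (le_trans (leeD (measureU2 _ mL mM) (lexx _))).
apply: le_trans (leeD (leeD large_sample_event_prob small_mean_event_prob) deviation_event_prob) _.
rewrite -!EFinD lee_fin.
set q := expR (- theta).
have q0 : 0 < q by exact: expR_gt0.
have qE : expR theta * q = 1 by rewrite -expRD subrr expR0.
have eE (m : nat) : expR (- (m%:R * theta)) = q ^+ m.
  by rewrite -mulrN expRM_natl.
rewrite !eE.
have pq : p%:R * q <= 1 by rewrite -[leRHS]qE ler_wpM2r// ltW.
have nq : n%:R * q <= 1 by rewrite -[leRHS]qE ler_wpM2r// ltW.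
have pR : 2 <= p%:R :> R by rewrite (ler_nat _ 2).
have nR : 2 <= n%:R :> R by rewrite (ler_nat _ 2).
rewrite -addn1 !natrM natrD.
move: (p%:R : R) (n%:R : R) pq nq pR nR => x y xq yq x2 y2.
have q2 : q <= 1 / 2 by nra.
have xy : x * q * (y * q) <= 1 by rewrite mulr_ile1// mulr_ge0//; lra.
have xx : x * q * (x * q) <= 1 by rewrite mulr_ile1// mulr_ge0//; lra.
have h1 : (y + 1) * x * (2 * q ^+ 6) <= 4 * q ^+ 4.
  have : (y + 1) * x * q ^+ 2 <= 2 * (x * q * (y * q)) by nra.
  have : 0 <= q ^+ 4 by rewrite exprn_ge0 ?ltW.
  rewrite (_ : (y + 1) * x * (2 * q ^+ 6) = (y + 1) * x * q ^+ 2 * (2 * q ^+ 4)); last by ring.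
  move: (q ^+ 4) => q4 q40 h; nra.
have h2 : (y + 1) * q ^+ 3 <= 2 * q ^+ 2.
  rewrite (_ : (y + 1) * q ^+ 3 = (y * q + q) * q ^+ 2); last by ring.
  by rewrite ler_wpM2r ?sqr_ge0//; lra.
have h3 : x * x * 2 * q ^+ 8 <= 2 * q ^+ 6.
  rewrite (_ : x * x * 2 * q ^+ 8 = x * q * (x * q) * (2 * q ^+ 6)); last by ring.
  by rewrite ler_piMl// mulr_ge0// exprn_ge0// ltW.
have q21 : q ^+ 2 <= q / 2 by nra.
have q41 : q ^+ 4 <= q ^+ 2 / 4.
  by rewrite (_ : q ^+ 4 = q ^+ 2 * q ^+ 2); [nra|ring].
have q61 : q ^+ 6 <= q ^+ 4 / 4.
  rewrite (_ : q ^+ 6 = q ^+ 4 * q ^+ 2); last by ring.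
  have : 0 <= q ^+ 4 by rewrite exprn_ge0// ltW.
  move: (q ^+ 4) (q ^+ 2) q21 => q4 q2' q21 q40; nra.
lra.
Qed.

End main.

(** * The rate and the proof of the theorem *)

Lemma half_le_ln (R : realType) (n : nat) : (2 <= n)%N -> 2^-1 <= ln n%:R :> R.
Proof.
move=> n2; have n0 : 0 < n%:R :> R by rewrite ltr0n (ltn_trans _ n2).
rewrite -ler_expR lnK ?posrE//; apply: (@le_trans _ _ 2); last by rewrite (ler_nat _ 2).
(* This says exp (1/2) <= 2. *)
have e1 : 1 + - 2^-1 <= expR (- 2^-1) :> R := expR_ge1Dx _.
have e2 : expR 2^-1 * expR (- 2^-1) = 1 :> R by rewrite -expRD subrr expR0.
have e3 : 0 < expR 2^-1 :> R := expR_gt0 _.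
nra.
Qed.

(** Each of ln p, ln n and theta is at least 1/2, so missing logarithms are inserted at the cost of
    factors 2 and 4, and the summand 1 is absorbed by 4 theta^2. *)
Lemma adap_rate_le (R : realType) (a b A theta : R) (p n : nat) :
  (2 <= p)%N -> (2 <= n)%N -> 0 <= a -> 0 <= b -> 2^-1 <= theta ->
  a * ln n%:R * (theta * Num.sqrt theta / Num.sqrt n%:R) +
    b * (1 + A ^+ 2 * theta ^+ 2) / n%:R <=
  4 * (a + b * (4 + A ^+ 2)) * (ln p%:R * ln n%:R *
            (theta `^ (3 / 2) / Num.sqrt n%:R + theta ^+ 2 / n%:R)).
Proof.
move=> p2 n2 a0 b0 th.
have th0 : 0 <= theta by lra.
have -> : theta `^ (3 / 2) = theta * Num.sqrt theta.
  have -> : 3 / 2 = 1 + 2^-1 :> R by lra.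
  rewrite powRD; last by apply/implyP => _; rewrite gt_eqF//; lra.
  by rewrite powRr1// powR12_sqrt.
have := half_le_ln R p2; have := half_le_ln R n2.
have u0 : 0 <= theta * Num.sqrt theta / Num.sqrt n%:R.
  by rewrite divr_ge0// mulr_ge0.
have n0 : 0 <= n%:R^-1 :> R by rewrite invr_ge0.
have bA : 0 <= b * (4 + A ^+ 2) by rewrite mulr_ge0// addr_ge0 ?sqr_ge0.
have v0 : 0 <= theta ^+ 2 / n%:R by rewrite divr_ge0// sqr_ge0.
have hv : b * (1 + A ^+ 2 * theta ^+ 2) / n%:R <= b * (4 + A ^+ 2) * (theta ^+ 2 / n%:R).
  rewrite [leRHS]mulrA ler_wpM2r// -mulrA ler_wpM2l//.
  have : 1 <= 4 * theta ^+ 2 by nra.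
  lra.
move: (theta * _ / _) u0 (theta ^+ 2 / _) v0 hv => u u0 v v0 hv.
move: (ln n%:R) (ln p%:R) => x y hx hy; apply: (le_trans (lerD (lexx _) hv)).
move: (b * (4 + _)) bA => c c0.
have x0 : 0 <= x by lra.
have y0 : 0 <= y by lra.
have h1 : x * u <= 2 * (y * x * u) by have := mulr_ge0 x0 u0; nra.
have h2 : v <= 4 * (y * x * v).
  have : 1 <= 4 * (y * x) by nra.
  by nra.
have h3 : 0 <= y * x * u by rewrite !mulr_ge0.
have h4 : 0 <= y * x * v by rewrite !mulr_ge0.
have := ler_wpM2l a0 h1; have := ler_wpM2l c0 h2.
have := mulr_ge0 a0 h3; have := mulr_ge0 a0 h4; have := mulr_ge0 c0 h3.
have := mulr_ge0 c0 h4.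
have -> : a * x * u = a * (x * u) by ring.
have -> : 4 * (a + c) * (y * x * (u + v)) =
   4 * (a * (y * x * u)) + 4 * (a * (y * x * v)) + 4 * (c * (y * x * u)) + 4 * (c * (y * x * v)) by ring.
lra.
Qed.

Lemma probability_ge_of_bad d (T : measurableType d) (R : realType)
    (P : probability T R) (E G : set T) (e : R) :
  measurable E -> measurable G -> (P E <= e%:E)%E -> ~` E `<=` G ->
  ((1 - e)%:E <= P G)%E.
Proof.
move=> mE mG PE EG; apply: (@le_trans _ _ (P (~` E))).
  rewrite probability_setC// EFinB; exact: leeB.
by rewrite le_measure ?inE//; exact: measurableC.
Qed.

Lemma adap_estimatorE (R : realType) (p n : nat) (l : nat -> R)
    (x tau tau' : nat -> 'cV[R]_p) i j :
  adap_estimator n l x tau tau' i j =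
  2^-1 * adap_asym n l x tau tau' i j + 2^-1 * adap_asym n l x tau tau' j i.
Proof.
by rewrite /adap_estimator; move: (adap_asym _ _ _ _ _) => S; rewrite !mxE.
Qed.

(** Symmetrising averages the entries (i, j) and (j, i), which approximate the same number. *)
Lemma adap_estimator_near (R : realType) (p n : nat) (l : nat -> R)
    (x tau tau' : nat -> 'cV[R]_p) (Sig : 'M[R]_p) (D : R) :
  (forall i j, Sig i j = Sig j i) ->
  (forall i j, `|adap_asym n l x tau tau' i j - Sig i j| <= D) ->
  forall i j, `|adap_estimator n l x tau tau' i j - Sig i j| <= D.
Proof.
move=> symS h i j; rewrite adap_estimatorE.
have hij := h i j; have hji := h j i; rewrite symS in hji.
move: hij hji; rewrite !ler_norml => /andP[? ?] /andP[? ?].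
by apply/andP; split; lra.
Qed.

Theorem theorem3 (R : realType) (K : R) (hK : 0 < K) :
  exists C1 C2 C : R,
    [/\ 0 < C1, 0 < C2, 0 < C &
    forall (d : measure_display) (T : measurableType d) (P : probability T R)
      (p n : nat) (hp : (2 <= p)%N) (hn : (2 <= n)%N)
      (X : {RV P >-> p.-tuple R})
      (Xs Us Vs : nat -> {RV P >-> p.-tuple R})
      (M : 'M[R]_p) (lamt : nat -> T -> R) (theta : R),
      square_integrable X ->
      mean_zero X ->
      subgaussian K X ->
      (forall j, (j <= n)%N -> same_law (Xs j) X) ->
      (forall k, (1 <= k <= n)%N ->
         uniform_on_cube (Us k) /\ uniform_on_cube (Vs k)) ->
      mutually_independent (@sample_family _ _ _ P p n Xs Us Vs) ->
      (forall i j, 0 <= M i j <= 1) ->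
      M^T = M ->
      (forall k w, (1 <= k <= n)%N ->
         0 <= lamt k w /\
         lamt k w ^+ 2 =
           C1 * ln k%:R * adap_lambda (fun j => colv (Xs j w)) k ^+ 2) ->
      C2 * Num.max (ln p%:R) (ln n%:R) <= theta ->
      let Sigma := covmx X in
      let Sigma_adap w := adap_estimator n (fun k => lamt k w)
            (fun k => colv (Xs k w))
            (fun k => lamt k w *: colv (Us k w))
            (fun k => lamt k w *: colv (Vs k w)) in
      let err w := hadamard M (Sigma_adap w) - hadamard M Sigma in
      let rate := ln p%:R * ln n%:R *
            (theta `^ (3 / 2) / Num.sqrt n%:R + theta ^+ 2 / n%:R) in
      let good := [set w | `|err w| <= C * (`|M| * `|Sigma| * rate) /\
                           frobenius (err w) <=
                             C * (frobenius M * `|Sigma| * rate)] in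
      ((1 - 2 * expR (- theta))%:E <= P good)%E].
Proof.
pose C1 := 256 * K ^+ 2 * (32 * K ^+ 2) ^+ 2.
pose A := 24 * (32 * K ^+ 2) ^+ 2.
(* The constant of [adap_rate_le] for the two coefficients that appear in [outside_events]. *)
pose C := 4 * (384 * K ^+ 2 * C1 + 64 * K ^+ 2 * (4 + A ^+ 2)).
have K2 : 0 < K ^+ 2 by rewrite exprn_gt0.
have C10 : 0 < C1 := mulr_gt0 (mulr_gt0 (ltr0n _ 256) K2)
  (exprn_gt0 2 (mulr_gt0 (ltr0n _ 32) K2)).
have a0 : 0 < 384 * K ^+ 2 * C1 := mulr_gt0 (mulr_gt0 (ltr0n _ 384) K2) C10.
have b0 : 0 < 64 * K ^+ 2 := mulr_gt0 (ltr0n _ 64) K2.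
have A4 : 0 < 4 + A ^+ 2 := ltr_wpDr (sqr_ge0 A) (ltr0n _ 4).
have C0 : 0 < C := mulr_gt0 (ltr0n _ 4) (addr_gt0 a0 (mulr_gt0 b0 A4)).
(* C2 = 1 suffices: it yields ln p <= theta and ln n <= theta, that is p, n <= exp theta, as the
   union bounds require. *)
exists C1, 1, C; split; [exact: C10|exact: ltr01|exact: C0|].
move=> d T P p n hp hn X Xs Us Vs M lamt theta.
move=> hX _ subX lawX unifUV indF _ _ hlam hth.
cbv zeta; set Sigma := covmx X.
pose err w := hadamard M (adap_estimator n (fun k => lamt k w)
  (fun k => colv (Xs k w)) (fun k => lamt k w *: colv (Us k w))
  (fun k => lamt k w *: colv (Vs k w))) - hadamard M Sigma.
set rate := ln p%:R * ln n%:R * _.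
set good := [set w | _].
have [p0 n0] : (0 < p)%N /\ (0 < n)%N by rewrite (ltn_trans _ hp)// (ltn_trans _ hn).
have [lnp lnn] : ln p%:R <= theta /\ ln n%:R <= theta.
  by move: hth; rewrite mul1r ge_max => /andP.
have th2 : 2^-1 <= theta := le_trans (half_le_ln R hp) lnp.
have th0 : 0 < theta by lra.
have symS i j : Sigma i j = Sigma j i.
  by rewrite !covmxE//; apply: eq_Rintegral => w _; rewrite mulrC.
have avg_ge0 k w := adap_lambda_ge0 (fun j => colv (Xs j w)) k.
(* Nonnegativity and the prescribed square determine the level; this formula in the samples is also
   the source of its measurability. *)
have lamtE k w : (1 <= k <= n)%N -> lamt k w =
    Num.sqrt (C1 * ln k%:R) * adap_lambda (fun j => colv (Xs j w)) k.
  move=> kn; have [l0 l2] := hlam k w kn.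
  rewrite -[LHS]ger0_norm// -sqrtr_sqr l2 sqrtrM; last first.
    by rewrite mulr_ge0 ?(ltW C10)// ln_ge0// ler1n; case/andP: kn.
  by rewrite sqrtr_sqr ger0_norm.
have mlam k : (1 <= k <= n)%N -> measurable_fun setT (lamt k : T -> R).
  move=> kn; rewrite (_ : lamt k = (fun w => Num.sqrt (C1 * ln k%:R) *
    adap_lambda (fun j => colv (Xs j w)) k)); last first.
    by apply/funext => w; exact: lamtE.
  by apply: measurable_funM => //; apply: adap_lambda_measurable.
have asymE w i j : adap_asym n (fun k => lamt k w) (fun k => colv (Xs k w))
    (fun k => lamt k w *: colv (Us k w)) (fun k => lamt k w *: colv (Vs k w)) i j =
    n%:R^-1 * \sum_(1 <= k < n.+1) dithered_prod Xs Us Vs i j k (lamt k w) w.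
  by rewrite adap_asymE; congr (_ * _); apply: eq_bigr => k _; rewrite !mxE.
have masym i j : measurable_fun setT (fun w => n%:R^-1 *
    \sum_(1 <= k < n.+1) dithered_prod Xs Us Vs i j k (lamt k w) w).
  apply: measurable_funM => //; under eq_fun do rewrite big_add1 big_mkord.
  apply: measurable_sum => k; have kn : (1 <= k.+1 <= n)%N by rewrite ltn_ord.
  by apply: measurable_funM; apply: dithered_sign_measurable;
    (exact: mlam || exact: coord_measurable).
have merr i j : measurable_fun setT (fun w => err w i j).
  rewrite (_ : (fun w => _) = (fun w => M i j * (2^-1 * (n%:R^-1 *
      \sum_(1 <= k < n.+1) dithered_prod Xs Us Vs i j k (lamt k w) w) +
      2^-1 * (n%:R^-1 *
      \sum_(1 <= k < n.+1) dithered_prod Xs Us Vs j i k (lamt k w) w)) -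
      M i j * Sigma i j)).
    apply: measurable_funB => //; apply: measurable_funM => //.
    by apply: measurable_funD; apply: measurable_funM.
  apply/funext => w; rewrite /err mxE [X in X + _]mxE; congr (M i j * _ + _).
    by rewrite adap_estimatorE !asymE.
  by rewrite !mxE.
have mgood : measurable good.
  apply: measurableI.
    rewrite -[X in measurable X]setTI; apply: measurable_fun_le => //.
    exact: mx_norm_measurable.
  rewrite -[X in measurable X]setTI; apply: measurable_fun_le => //.
  exact: frobenius_measurable.
have rate0 : 0 <= rate.
  rewrite /rate mulr_ge0//.
    by rewrite mulr_ge0// ln_ge0// ler1n.
  by rewrite addr_ge0// divr_ge0// ?powR_ge0// sqr_ge0.
have good_of w : (forall i j, `|n%:R^-1 *
    \sum_(1 <= k < n.+1) dithered_prod Xs Us Vs i j k (lamt k w) w - Sigma i j|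
    <= C * (`|Sigma| * rate)) -> good w.
  move=> h; have D0 : 0 <= C * (`|Sigma| * rate).
    by rewrite mulr_ge0 ?(ltW C0)// mulr_ge0.
  have hS := adap_estimator_near symS (fun i j => eq_rect_r (fun z => `|z - Sigma i j| <= _) (h i j) (asymE w i j)).
  have E (m : R) : C * (m * `|Sigma| * rate) = m * (C * (`|Sigma| * rate)) by ring.
  split; rewrite E; first exact: hadamard_sub_norm_le.
  exact: hadamard_sub_frobenius_le.
have [i0 SE] := normr_covmx_max (Ordinal p0) hX; rewrite -/Sigma in SE.
have diagS a : Sigma a a <= `|Sigma|.
  by apply: le_trans (ler_norm _) (entry_le_mx_norm _ _ _).
(* If Sigma = 0 then all samples, hence the estimator, vanish almost surely. *)
have [S0|S0] : `|Sigma| = 0 \/ 0 < `|Sigma|.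
  by have [->|] := eqVneq Sigma 0; [left; exact: normr0|right; rewrite normr_gt0].
- pose E := \bigcup_(ka : 'I_n.+1 * 'I_p) [set w | tnth (Xs ka.1 w) ka.2 != 0].
  have mE1 (ka : 'I_n.+1 * 'I_p) : measurable [set w | tnth (Xs ka.1 w) ka.2 != 0].
    rewrite [X in measurable X](_ : _ = ~` ((fun w => tnth (Xs ka.1 w) ka.2) @^-1` [set 0])).
      apply: measurableC; rewrite -[X in measurable X]setTI.
      exact: (coord_measurable (Xs ka.1) ka.2).
    by apply/seteqP; split=> w /= /eqP.
  apply: (@probability_ge_of_bad _ _ _ P E) => //.
  + by apply: fin_bigcup_measurable.
  + apply: (@le_trans _ _ (#|{: 'I_n.+1 * 'I_p}|%:R * 0)%:E).
      apply: union_bound => // -[k a] /=.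
      rewrite (same_law_coord_null (X := X))//; first by apply: lawX; rewrite -ltnS.
      apply/eqP; rewrite -normr_le0 -S0; exact: entry_le_mx_norm.
    by rewrite mulr0 lee_fin mulr_ge0// expR_ge0.
  + move=> w nE; apply: good_of => i j.
    have X0 k a : (k <= n)%N -> tnth (Xs k w) a = 0.
      rewrite -ltnS => kn; apply/eqP/negPn/negP => Xn; apply: nE.
      by exists (Ordinal kn, a).
    rewrite big_nat big1 ?mulr0 ?sub0r ?normrN.
      by rewrite S0 mul0r mulr0 -S0; exact: entry_le_mx_norm.
    move=> k kn; rewrite lamtE// /dithered_prod.
    rewrite /adap_lambda big_nat big1 ?mulr0 ?mul0r// => l /andP[_ lk].
    apply/eqP; rewrite -normr_le0 normr_id; apply: mx_norm_le => // a b.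
    by rewrite mxE X0 ?normr0// (leq_trans (ltnW lk))//; case/andP: kn.
have psi2X k a : (k <= n)%N ->
    psi2_bound P (fun w => tnth (Xs k w) a) (2 * K * Num.sqrt `|Sigma|).
  move=> kn; apply: same_law_psi2_bound (lawX k kn) _.
  exact: subgaussian_psi2_bound.
have covX k i j : (k <= n)%N ->
    \int[P]_w (tnth (Xs k w) i * tnth (Xs k w) j) = Sigma i j.
  by move=> kn; apply: same_law_covmx => //; exact: lawX.
have p_le : p%:R <= expR theta by rewrite -ler_ln ?posrE ?expR_gt0 ?ltr0n// expRK.
have n_le : n%:R <= expR theta by rewrite -ler_ln ?posrE ?expR_gt0 ?ltr0n// expRK.
have bad := bad_event_prob indF unifUV hp hn hK S0 psi2X covX (esym SE) p_le n_le th0 lamtE.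
apply: (probability_ge_of_bad _ mgood bad).
  apply: measurableU; first apply: measurableU.
  - exact: large_sample_event_measurable.
  - exact: small_mean_event_measurable.
  - exact: deviation_event_measurable lamtE.
move=> w; rewrite !setCU => -[[nL nM] nD]; apply: good_of => i j.
apply: le_trans (outside_events hn hK S0 th0 lamtE i j nL nM nD) _.
rewrite [leRHS]mulrCA ler_wpM2l//.
exact: adap_rate_le hp hn (ltW a0) (ltW b0) th2.
Qed.
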